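(* Let $n\in\mathbb{N}$, $n\ge 1$. Any continuous linear functional $x^*$ on $C_{\lim}(\mathbb{R},\mathbb{R}^n)$ can be uniquely represented in the form $$\langle x^*,x(\cdot)\rangle=\int_{-\infty}^\infty\langle x(t),d\mu(t)\rangle+\alpha_1^T x(-\infty)+\alpha_2^T x(\infty)\qquad\text{for all } x(\cdot)\in C_{\lim}(\mathbb{R},\mathbb{R}^n),$$ where $\mu=(\mu_1,\dots,\mu_n)$ is a vector of signed regular Borel measures on $\mathbb{R}$ and $\alpha_1,\alpha_2\in\mathbb{R}^n$; or equivalently (and again uniquely) in the form $$\langle x^*,x(\cdot)\rangle=\int_{-\infty}^\infty\langle x(t),d\tilde\mu(t)\rangle\qquad\text{for all } x(\cdot)\in C_{\lim}(\mathbb{R},\mathbb{R}^n),$$ where $\tilde\mu=(\tilde\mu_1,\dots,\tilde\mu_n)$ is a vector of signed regular Borel measures $\tilde\mu_1,\dots,\tilde\mu_n\in\mathscr{M}(\overline{\mathbb{R}})$ and the last integral is taken over $\overline{\mathbb{R}}=[-\infty,\infty]$ (including the points $\pm\infty$).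
   Context: $C_{\lim}(\mathbb{R},\mathbb{R}^n)$ is the Banach space of all continuous functions $x(\cdot):\mathbb{R}\to\mathbb{R}^n$ for which both limits $x(\infty):=\lim_{t\to\infty}x(t)$ and $x(-\infty):=\lim_{t\to-\infty}x(t)$ exist in $\mathbb{R}^n$, with the supremum norm; each such function is regarded as defined on $\overline{\mathbb{R}}$ with values $x(\pm\infty)$ at $\pm\infty$. $\overline{\mathbb{R}}=[-\infty,\infty]$ is the extended real line with its usual compact topology (homeomorphic to $[-1,1]$). The Borel algebra on $\overline{\mathbb{R}}$ consists of all sets $A\cup E$ with $A$ a Borel subset of $\mathbb{R}$ and $E\subseteq\{-\infty,\infty\}$. Signed regular Borel measures are finite signed Borel measures whose total variation is inner regular with respect to compact sets and outer regular with respect to open sets. $\mathscr{M}(\overline{\mathbb{R}})$ is the set of signed regular Borel measures on $\overline{\mathbb{R}}$; each is uniquely of the form $\nu+\nu_{-\infty}+\nu_\infty$ with $\nu$ a signed regular Borel measure on $\mathbb{R}$ and $\nu_{\pm\infty}$ signed measures concentrated at $\pm\infty$. For a vector of measures, $\int\langle x(t),d\mu(t)\rangle=\sum_{i=1}^n\int x_i(t)\,d\mu_i(t)$. *)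

(* Defs.v *)
From HB Require Import structures.
From mathcomp Require Import all_boot all_order all_algebra.
From mathcomp Require Import all_classical all_reals all_analysis.
From mathcomp Require Import measurable_realfun.

Set Implicit Arguments.
Unset Strict Implicit.
Unset Printing Implicit Defensive.

Import Order.TTheory GRing.Theory Num.Theory.
Import numFieldNormedType.Exports.

Local Open Scope classical_set_scope.
Local Open Scope ring_scope.

Section clim_def.
Variables (R : realType) (n : nat).

Definition is_clim (x : R -> 'cV[R]_n) : Prop :=
  [/\ continuous x, cvg (x t @[t --> -oo]) & cvg (x t @[t --> +oo])].

Definition clim_pred : {pred (R -> 'cV[R]_n)} := fun x => `[< is_clim x >].

Record clim := Clim { clim_val :> R -> 'cV[R]_n ; _ : clim_val \in clim_pred }.

HB.instance Definition _ := [isSub for clim_val].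
HB.instance Definition _ := [Choice of clim by <:].

Lemma climP (x : clim) : is_clim x.
Proof. by apply/asboolP; exact: (valP x). Qed.

Lemma clim_submod_closed : submod_closed clim_pred.
Proof.
split=> [|a x y /asboolP[xc xN xP] /asboolP[yc yN yP]]; apply/asboolP.
  by split; [move=> t; exact: cvg_cst|exact: is_cvg_cst|exact: is_cvg_cst].
split.
- move=> t; apply: (@cvgD _ _ _ (nbhs t) _ (a *: x) y); last exact: yc.
  by apply: cvgZl_tmp; exact: xc.
- apply: (@is_cvgD _ _ _ _ _ (a *: x) y); last exact: yN.
  exact: (@is_cvgZl_tmp _ _ _ _ _ _ x xN).
- apply: (@is_cvgD _ _ _ _ _ (a *: x) y); last exact: yP.
  exact: (@is_cvgZl_tmp _ _ _ _ _ _ x xP).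
Qed.

HB.instance Definition _ := GRing.isSubmodClosed.Build R (R -> 'cV[R]_n)
  clim_pred clim_submod_closed.
HB.instance Definition _ := [SubChoice_isSubLmodule of clim by <:].

(* The norm on column vectors is the maximum norm; any other norm on R^n would
   give an equivalent norm on clim, hence the same continuous functionals. *)
Definition supnorm (x : clim) : R := sup [set `|x t| | t in [set: R]].

Lemma clim_bounded (x : clim) : exists M, forall t, `|x t| <= M.
Proof.
have [xc xN xP] := climP x.
have bd (F : set_system R) (FF : ProperFilter F) : cvg (x t @[t --> F]) ->
    exists M, \forall t \near F, `|x t| <= M.
  move=> /cvg_ex[/= l xl]; exists (`|l : 'cV[R]_n| + 1).
  by apply: (cvgr_norm_le (l : 'cV[R]_n)); [exact: xl|rewrite ltrDl].
have [M1 [a [ar aM]]] := bd _ _ xN.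
have [M2 [b [br bM]]] := bd _ _ xP.
have : compact (x @` `[a - 1, b + 1]).
  apply: continuous_compact; last exact: segment_compact.
  by apply: continuous_subspaceT => t; exact: xc.
move=> /compact_bounded[M0 [M0r M0P]].
exists (Num.max (M0 + 1) (Num.max M1 M2)) => t; rewrite !le_max.
have [ta|ta] := ltP t a; first by rewrite aM ?orbT.
have [tb|tb] := ltP b t; first by rewrite bM ?orbT.
rewrite M0P ?ltrDl//=; exists t => //=; rewrite in_itv/=.
apply/andP; split.
  by apply: le_trans ta; rewrite lerBlDr lerDl.
by apply: (le_trans tb); rewrite lerDl.
Qed.

Lemma supnorm_has_sup (x : clim) : has_sup [set `|x t| | t in [set: R]].
Proof.
split; first by exists `|x 0|; exists 0.
by have [M xM] := clim_bounded x; exists M => _ [t _ <-].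
Qed.

Lemma supnorm_ub (x : clim) t : `|x t| <= supnorm x.
Proof. by apply: sup_upper_bound; [exact: supnorm_has_sup|exists t]. Qed.

Lemma supnorm_le (x : clim) M : (forall t, `|x t| <= M) -> supnorm x <= M.
Proof.
move=> xM; apply: sup_le_ub; first by exists `|x 0|; exists 0.
by move=> _ [t _ <-].
Qed.

Lemma supnormD (x y : clim) : supnorm (x + y) <= supnorm x + supnorm y.
Proof.
apply: supnorm_le => t.
apply: le_trans (ler_normD (x t) (y t)) _.
exact: lerD (supnorm_ub x t) (supnorm_ub y t).
Qed.

Lemma supnormZ (a : R) (x : clim) : supnorm (a *: x) = `|a| * supnorm x.
Proof.
have leZ b y : supnorm (b *: y) <= `|b| * supnorm y.
  apply: supnorm_le => t; rewrite [X in `|X|](_ : _ = b *: y t)//.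
  by rewrite normrZ ler_wpM2l ?supnorm_ub.
apply/eqP; rewrite eq_le leZ/=; have [->|a0] := eqVneq a 0.
  by rewrite normr0 mul0r (le_trans (normr_ge0 (_ 0)) (supnorm_ub _ 0)).
rewrite -ler_pdivlMl ?normr_gt0// -normfV.
by have := leZ a^-1 (a *: x); rewrite scalerA mulVf// scale1r.
Qed.

Lemma supnorm0_eq0 (x : clim) : supnorm x = 0 -> x = 0.
Proof.
move=> x0; apply/val_inj/funext => t /=; apply/eqP.
by rewrite -normr_le0 -x0 supnorm_ub.
Qed.

HB.instance Definition _ := Lmodule_isNormed.Build R clim
  supnormD supnormZ supnorm0_eq0.

End clim_def.

(* The continuous extension of x to [-oo, +oo], written x(-oo), x(+oo) at the
   endpoints. *)
Definition clim_ext (R : realType) (n : nat) (x : clim R n) (t : \bar R) :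
    'cV[R]_n :=
  match t with
  | r%:E => x r
  | +oo%E => lim (x r @[r --> +oo])
  | -oo%E => lim (x r @[r --> -oo])
  end.

Section charge_integral.
Context d (T : measurableType d) (R : realType).
Implicit Type nu : {charge set T -> \bar R}.

(* A Hahn decomposition is unique up to null sets, so the Jordan parts and the
   total variation below do not depend, on measurable sets, on the choice. *)
Definition hahn_sets nu :
  {PN : set T * set T | hahn_decomposition nu PN.1 PN.2}.
Proof.
by apply: cid; have [P [N nuPN]] := Hahn_decomposition nu; exists (P, N).
Qed.

Definition positive_variation nu := jordan_pos (projT2 (hahn_sets nu)).
Definition negative_variation nu := jordan_neg (projT2 (hahn_sets nu)).
Definition total_variation nu := charge_variation (projT2 (hahn_sets nu)).

Definition charge_integral nu (f : T -> R) : R :=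
  \int[positive_variation nu]_t f t - \int[negative_variation nu]_t f t.

Definition vector_charge_integral n (mu : 'I_n -> {charge set T -> \bar R})
    (x : T -> 'cV[R]_n) : R :=
  \sum_(i < n) charge_integral (mu i) (fun t => x t i 0).

End charge_integral.

(* M is the class of measurable sets on which regularity is required. *)
Definition inner_regular (R : realType) (T : topologicalType) (M : set (set T))
    (m : set T -> \bar R) : Prop :=
  forall A, M A ->
    m A = ereal_sup [set m K | K in [set K | compact K /\ K `<=` A]].

Definition outer_regular (R : realType) (T : topologicalType) (M : set (set T))
    (m : set T -> \bar R) : Prop :=
  forall A, M A ->
    m A = ereal_inf [set m U | U in [set U | open U /\ A `<=` U]].

Section representations.
Variables (R : realType) (n : nat).

Definition regular_charge (nu : {charge set R -> \bar R}) : Prop :=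
  inner_regular (T := R) (@measurable _ R) (total_variation nu) /\
  outer_regular (T := R) (@measurable _ R) (total_variation nu).

(* The measurable sets of \bar R are EFin @` A `|` E with A Borel in R and E a
   set of infinite points (emeasurable). *)
Definition regular_echarge (nu : {charge set (\bar R) -> \bar R}) : Prop :=
  inner_regular (T := \bar R) (@measurable _ (\bar R)) (total_variation nu) /\
  outer_regular (T := \bar R) (@measurable _ (\bar R)) (total_variation nu).

Definition represents (phi : clim R n -> R)
    (mu : 'I_n -> {charge set R -> \bar R}) (a1 a2 : 'cV[R]_n) : Prop :=
  (forall i, regular_charge (mu i)) /\
  forall x : clim R n,
    phi x = vector_charge_integral mu x + (a1^T *m clim_ext x -oo%E) 0 0
            + (a2^T *m clim_ext x +oo%E) 0 0.

Definition erepresents (phi : clim R n -> R)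
    (mu : 'I_n -> {charge set (\bar R) -> \bar R}) : Prop :=
  (forall i, regular_echarge (mu i)) /\
  forall x : clim R n, phi x = vector_charge_integral mu (clim_ext x).

End representations.

Lemma measurable_EFin (R : realType) : measurable_fun [set: R] (@EFin R).
Proof. exact/measurable_EFinP/measurable_id. Qed.

(* nu seen as a measure on \bar R that is null at -oo and +oo. *)
Definition efin_charge (R : realType) (nu : {charge set R -> \bar R}) :
    {charge set (\bar R) -> \bar R} :=
  measure_function_pushforward__canonical__charge_Charge nu (@measurable_EFin R).

Lemma efin_chargeE (R : realType) (nu : {charge set R -> \bar R})
    (A : set (\bar R)) :
  efin_charge nu A = nu (EFin @^-1` A).
Proof. by []. Qed.

(* The measure nu + a \d_(-oo) + b \d_(+oo) on \bar R. *)
Definition echarge_of (R : realType) (nu : {charge set R -> \bar R})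
    (a b : R) : {charge set (\bar R) -> \bar R} :=
  cadd (efin_charge nu)
    (cadd (cscale a (charge_of_finite_measure \d_(-oo%E : \bar R)))
          (cscale b (charge_of_finite_measure \d_(+oo%E : \bar R)))).

Lemma echarge_ofE (R : realType) (nu : {charge set R -> \bar R}) (a b : R)
    (A : set (\bar R)) :
  echarge_of nu a b A =
  (nu (EFin @^-1` A) + (a%:E * \d_(-oo) A + b%:E * \d_(+oo) A))%E.
Proof. by []. Qed.

(* Main.v *)
Require Import Defs.
From HB Require Import structures.
From mathcomp Require Import all_boot all_order all_algebra.
From mathcomp Require Import all_classical all_reals all_analysis.
From mathcomp Require Import measurable_realfun.
From mathcomp Require Import ring lra.

(** Extending functions by their limits identifies [clim R n] with the continuous
    functions on the compact space [\bar R], and splitting them into coordinates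
    reduces the statement to the Riesz representation theorem for scalar
    functions on [\bar R].

    Existence.  A bounded functional [psi] is the difference of two positive ones,
    the positive part being [f |-> sup {psi g | 0 <= g <= f}] on [f >= 0].  A
    positive functional [L] has a distribution function [F], obtained by testing
    [L] on ramps, the continuous piecewise affine versions of the indicator of a
    lower half-line.  The Stieltjes measure of [F], completed by point masses at
    the two infinities, has the same values as [L] on all ramps
    ([positive_functional_ramp]).  Ramps and constants span a subspace that is
    dense for the supremum norm ([ramp_approximation]), hence the representation
    of [psi] on all continuous functions ([bounded_functional_integral]).

    Uniqueness.  The integrals of ramps squeeze the distribution function of a
    finite measure on [\bar R], and the latter determines the measure; charges are
    reduced to measures by moving the negative parts to the other side
    ([charge_unique_continuous]).

    Every finite Borel measure on [R] or [\bar R] is regular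
    ([R_measure_regular], [ereal_measure_regular]).  The passage between the two
    forms of the representation is then the computation of the integral against
    [echarge_of nu a b] ([represents_echarge_of]), and the uniqueness in the
    first form follows from that in the second. *)

Set Implicit Arguments.
Unset Strict Implicit.
Unset Printing Implicit Defensive.

Import Order.TTheory GRing.Theory Num.Theory.
Import numFieldNormedType.Exports.

Local Open Scope classical_set_scope.
Local Open Scope ring_scope.

(** * Integration against charges *)

Section charge_integral_theory.
Context d (T : measurableType d) (R : realType).
Implicit Types (nu : {charge set T -> \bar R}) (f : T -> R).

Lemma Rintegral_measure_add (m1 m2 : {measure set T -> \bar R}) f :
  (m1 setT < +oo)%E -> (m2 setT < +oo)%E ->
  measurable_fun setT f -> [bounded f x | x in setT] ->
  \int[measure_add m1 m2]_x f x = \int[m1]_x f x + \int[m2]_x f x.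
Proof.
move=> m1oo m2oo mf bf; rewrite /Rintegral integral_measure_add//.
- by rewrite fineD//; apply: integrable_fin_num => //;
    exact: measurable_bounded_integrable.
- exact: measurable_bounded_integrable.
- exact: measurable_bounded_integrable.
Qed.

Lemma jordan_variationE nu (A : set T) : measurable A ->
  nu A = (positive_variation nu A - negative_variation nu A)%E.
Proof.
by move=> mA; rewrite (jordan_decomp (projT2 (hahn_sets nu)) mA)/= /cadd/= cscaleN1.
Qed.

(** The integral does not depend on how the charge is written as a difference of
    finite measures: if [p - q = m1 - m2], then [p + m2 = m1 + q] is an equality
    of measures, and integrating it gives the claim.  All the linearity
    properties below follow, the Jordan parts of a sum or of a multiple never
    having to be computed. *)
Lemma charge_integral_diff nu (m1 m2 : {measure set T -> \bar R}) f :
  (m1 setT < +oo)%E -> (m2 setT < +oo)%E ->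
  (forall A, measurable A -> nu A = m1 A - m2 A)%E ->
  measurable_fun setT f -> [bounded f x | x in setT] ->
  charge_integral nu f = \int[m1]_x f x - \int[m2]_x f x.
Proof.
move=> m1oo m2oo nuE mf bf; rewrite /charge_integral.
set p := positive_variation nu; set q := negative_variation nu.
have poo : (p setT < +oo)%E by rewrite ltey_eq fin_num_measure.
have qoo : (q setT < +oo)%E by rewrite ltey_eq fin_num_measure.
have fin (m : {measure set T -> \bar R}) A :
    (m setT < +oo)%E -> measurable A -> m A \is a fin_num.
  move=> moo mA; rewrite ge0_fin_numE//; apply: le_lt_trans moo.
  by apply: le_measure => //; rewrite inE.
suff : \int[p]_x f x + \int[m2]_x f x = \int[m1]_x f x + \int[q]_x f x by lra.
rewrite -!Rintegral_measure_add//.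
congr fine; apply: eq_measure_integral => A mA _.
rewrite -[X in X = _]/(measure_add _ _ A) -[X in _ = X]/(measure_add _ _ A).
rewrite !measure_addE.
change (p A + m2 A = m1 A + q A)%E.
have := nuE _ mA; rewrite (jordan_variationE nu mA) -/p -/q.
have : p A \is a fin_num by exact: fin.
have : q A \is a fin_num by exact: fin.
have : m1 A \is a fin_num by exact: fin.
have : m2 A \is a fin_num by exact: fin.
case: (p A) => //= pA; case: (q A) => //= qA.
case: (m1 A) => //= a; case: (m2 A) => //= b _ _ _ _.
move=> [h]. by congr EFin; lra.
Qed.


Lemma Rintegral_mscale (k : {nonneg R}) (m : {measure set T -> \bar R}) f :
  (m setT < +oo)%E -> measurable_fun setT f -> [bounded f x | x in setT] ->
  \int[mscale k m]_x f x = k%:num * \int[m]_x f x.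
Proof.
move=> moo mf bf; have If := measurable_bounded_integrable measurableT moo mf bf.
have /measurable_EFinP mEf := mf.
rewrite /Rintegral integralE [in RHS]integralE.
rewrite !ge0_integral_mscale//; last 2 first.
- exact: measurable_funeneg.
- exact: measurable_funepos.
have : (\int[m]_x ((EFin \o f)^\+)%E x \is a fin_num)%E.
  by apply: integrable_fin_num => //; exact: integrable_funepos.
have : (\int[m]_x ((EFin \o f)^\-)%E x \is a fin_num)%E.
  by apply: integrable_fin_num => //; exact: integrable_funeneg.
set u := (\int[m]_x ((EFin \o f)^\-)%E x)%E.
set v := (\int[m]_x ((EFin \o f)^\+)%E x)%E.
by case: u => // u _; case: v => // v _; rewrite /= mulrBr.
Qed.

Lemma charge_integral_cadd nu nu' f :
  measurable_fun setT f -> [bounded f x | x in setT] ->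
  charge_integral (cadd nu nu') f = charge_integral nu f + charge_integral nu' f.
Proof.
move=> mf bf.
have oo (m : {finite_measure set T -> \bar R}) : (m setT < +oo)%E.
  by rewrite ltey_eq fin_num_measure.
have fn (m : {finite_measure set T -> \bar R}) A : measurable A -> m A \is a fin_num.
  exact: fin_num_measure.
have aoo (m m' : {finite_measure set T -> \bar R}) : (measure_add m m' setT < +oo)%E.
  by rewrite measure_addE lte_add_pinfty ?oo.
rewrite (@charge_integral_diff _
  (measure_add (positive_variation nu) (positive_variation nu'))
  (measure_add (negative_variation nu) (negative_variation nu'))) ?aoo//.
  by rewrite !Rintegral_measure_add ?oo// /charge_integral; lra.
move=> A mA; rewrite /= /cadd/= (jordan_variationE nu mA) (jordan_variationE nu' mA).
rewrite -[X in _ = (X - _)%E]/(measure_add _ _ A).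
rewrite -[X in _ = (_ - X)%E]/(measure_add _ _ A).
rewrite !measure_addE addeACA oppeD//.
by rewrite fin_num_adde_defr// fn.
Qed.

Lemma charge_integral_cscale (a : R) nu f :
  measurable_fun setT f -> [bounded f x | x in setT] ->
  charge_integral (cscale a nu) f = a * charge_integral nu f.
Proof.
move=> mf bf.
have oo (m : {finite_measure set T -> \bar R}) : (m setT < +oo)%E.
  by rewrite ltey_eq fin_num_measure.
have soo k (m : {finite_measure set T -> \bar R}) : (mscale k m setT < +oo)%E.
  by rewrite /mscale lte_mul_pinfty ?oo.
have fn (m : {finite_measure set T -> \bar R}) A : measurable A -> m A \is a fin_num.
  exact: fin_num_measure.
have [a0|a0] := leP 0 a.
  rewrite (@charge_integral_diff _ (mscale (NngNum a0) (positive_variation nu))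
    (mscale (NngNum a0) (negative_variation nu))) ?soo//.
    by rewrite !Rintegral_mscale ?oo// /charge_integral/= mulrBr.
  move=> A mA; rewrite /= /cscale/= (jordan_variationE nu mA) /mscale/=.
  by rewrite muleBr// fin_num_adde_defr// fn.
have a0' : 0 <= - a by rewrite oppr_ge0 ltW.
rewrite (@charge_integral_diff _ (mscale (NngNum a0') (negative_variation nu))
  (mscale (NngNum a0') (positive_variation nu))) ?soo//.
  by rewrite !Rintegral_mscale ?oo// /charge_integral/=; lra.
move=> A mA; rewrite /= /cscale/= (jordan_variationE nu mA) /mscale/=.
rewrite muleBr//; last by rewrite fin_num_adde_defr// fn.
by rewrite EFinN !mulNe oppeK addeC.
Qed.

Lemma charge_integral_measure (m : {finite_measure set T -> \bar R}) f :
  measurable_fun setT f -> [bounded f x | x in setT] ->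
  charge_integral (charge_of_finite_measure m) f = \int[m]_x f x.
Proof.
move=> mf bf; rewrite (@charge_integral_diff _ m mzero)//.
- by rewrite /Rintegral integral_measure_zero subr0.
- by rewrite ltey_eq fin_num_measure.
- by rewrite /mzero ltey.
- by move=> A mA; rewrite /mzero sube0.
Qed.

End charge_integral_theory.

Lemma charge_integral_pushforward d d' (T : measurableType d)
    (T' : measurableType d') (R : realType) (h : T -> T') (mh : measurable_fun setT h)
    (nu : {charge set T -> \bar R}) (f : T' -> R) :
  measurable_fun setT f -> [bounded f x | x in setT] ->
  charge_integral (measure_function_pushforward__canonical__charge_Charge nu mh) f =
  charge_integral nu (f \o h).
Proof.
move=> mf bf.
have oo (m : {finite_measure set T -> \bar R}) : (m setT < +oo)%E.
  by rewrite ltey_eq fin_num_measure.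
have bfh : [bounded (f \o h) x | x in setT].
  by have [M [Mr Mb]] := bf; exists M; split=> // N MN x _; exact: (Mb N MN (h x)).
have mfh : measurable_fun setT (f \o h) by exact: measurableT_comp.
pose push (m : {measure set T -> \bar R}) : {measure set T' -> \bar R} :=
  measure_function_pushforward__canonical__measure_function_Measure m mh.
have pE (m : {finite_measure set T -> \bar R}) :
    \int[push m]_x f x = \int[m]_x f (h x).
  rewrite /Rintegral integral_pushforward ?preimage_setT//.
  - exact/measurable_EFinP.
  - exact: measurable_bounded_integrable measurableT (oo m) mfh bfh.
rewrite (@charge_integral_diff _ _ _ _
  (push (positive_variation nu)) (push (negative_variation nu)))//.
- by rewrite !pE.
- exact: oo.
- exact: oo.
move=> A mA; apply: (jordan_variationE nu).
by have := mh measurableT A mA; rewrite setTI.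
Qed.

(** * Topology and Borel sets of the extended real line *)

Section ereal_topology.
Variable R : realType.
Implicit Types (A U : set (\bar R)).

(** An ultrafilter converges to the supremum of the [x] whose up-set it
    contains. *)
Lemma ereal_compact : compact [set: \bar R].
Proof.
rewrite compact_ultra => F FU _; pose S := [set x | F [set y | x <= y]%E].
have lo a : (a < ereal_sup S)%E -> F [set y | a < y]%E.
  move=> /ereal_sup_gt[x Sx ax]; apply: filterS Sx => y /=.
  exact: lt_le_trans.
have hi b : (ereal_sup S < b)%E -> F [set y | y < b]%E.
  move=> Sb; have [Fb|] := in_ultra_setVsetC [set y | b <= y]%E FU.
    by move: Sb; rewrite ltNge ereal_sup_ubound.
  by apply: filterS => y /= /negP; rewrite -ltNge.
exists (ereal_sup S); split => // A.
case: (ereal_sup S) lo hi => [r||] lo hi.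
- move=> [e /= e0 eA].
  have l : F [set y | (r - e)%:E < y]%E by apply: lo; rewrite lte_fin ltrBlDr ltrDl.
  have h : F [set y | y < (r + e)%:E]%E by apply: hi; rewrite lte_fin ltrDl.
  apply: filterS (filterI l h) => -[y||] /= [] //; rewrite !lte_fin => ly hy.
  by apply: eA => /=; rewrite ltr_norml; lra.
- move=> [M [_ MA]]; apply: filterS (lo M%:E (ltry _)) => y /=.
  exact: MA.
- move=> [M [_ MA]]; apply: filterS (hi M%:E (ltNyr _)) => y /=.
  exact: MA.
Qed.

Lemma EFin_continuous : continuous (@EFin R).
Proof. by move=> r A. Qed.

Lemma ereal_open_measurable U : open U -> measurable U.
Proof.
move=> oU; exists (EFin @^-1` U).
  by apply: open_measurable; apply: open_comp => // r _; exact: EFin_continuous.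
exists (U `&` [set -oo%E; +oo%E]).
  by apply/ps_inftyP => x [].
apply/seteqP; split => [x [[r Ur <-]//|[]//]|[r||] Ux].
- by left; exists r.
- by right; split=> //; right.
- by right; split=> //; left.
Qed.

Lemma ereal_closed_measurable U : closed U -> measurable U.
Proof.
move=> cU; rewrite -(setCK U); apply/measurableC/ereal_open_measurable.
exact: closed_openC.
Qed.

Lemma ereal_continuous_measurable (f : \bar R -> R) :
  continuous f -> measurable_fun setT f.
Proof.
move=> cf; apply: (measurability _ (RGenOpens.measurableE R)).
move=> _ [_ [a [b ->] <-]]; rewrite setTI; apply: ereal_open_measurable.
by apply: open_comp => [x _|]; [exact: cf|exact: interval_open].
Qed.

Lemma ereal_continuous_bounded (f : \bar R -> R) :
  continuous f -> [bounded f x | x in setT].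
Proof.
move=> cf; have : compact (f @` setT).
  apply: continuous_compact ereal_compact.
  by apply: continuous_subspaceT => x; exact: cf.
move=> /compact_bounded[M [Mr Mb]]; exists M; split=> // N MN x _.
by apply: (Mb N MN); exists x.
Qed.

(** Asking for a closed set inside and an open set outside at once makes the
    approximable sets a sigma-algebra: complements exchange the two sides, and a
    countable union is approximated from inside by finitely many of the closed
    sets, by continuity from above of [m]. *)
Lemma ereal_measure_closed_open (m : {measure set (\bar R) -> \bar R}) A :
  (m setT < +oo)%E -> measurable A -> forall e : R, 0 < e ->
  exists F U, [/\ closed F, open U, F `<=` A, A `<=` U & (m (U `\` F) <= e%:E)%E].
Proof.
move=> moo.
pose good A := forall e : R, 0 < e ->
  exists F U, [/\ closed F, open U, F `<=` A, A `<=` U & (m (U `\` F) <= e%:E)%E].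
suff : @measurable _ (\bar R) `<=` good by apply.
have mFin B : measurable B -> (m B < +oo)%E.
  by move=> mB; apply: le_lt_trans moo; apply: le_measure => //; rewrite inE.
rewrite [measurable](ErealGenCInfty.measurableE R).
apply: smallest_sub => [|_ [r ->]].
  split.
  - move=> e e0; exists set0, set0; split.
    + exact: closed0.
    + exact: open0.
    + by [].
    + by [].
    + by rewrite set0D measure0 lee_fin ltW.
  - move=> B gB e e0; have [F [U [cF oU FB BU mUF]]] := gB e e0.
    exists (~` U), (~` F); split.
    + exact: open_closedC.
    + exact: closed_openC.
    + by rewrite setTD; exact: subsetC.
    + by rewrite setTD; exact: subsetC.
    + by rewrite setDE setCK setIC -setDE.
  - move=> B gB e e0.
    have /choice[f fP] i : exists FU : set (\bar R) * set (\bar R),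
        [/\ closed FU.1, open FU.2, FU.1 `<=` B i, B i `<=` FU.2 &
           (m (FU.2 `\` FU.1) <= (e / 2 / (2 ^ i.+1)%:R)%:E)%E].
      have [|F [U H]] := gB i (e / 2 / (2 ^ i.+1)%:R); last by exists (F, U).
      by rewrite !divr_gt0// ltr0n expn_gt0.
    (* The whole union of the closed sets need not be closed: [F n] is cut at a
       rank [n] to be chosen at the end, at the cost of the other [e / 2]. *)
    pose F n := \bigcup_(i < n) (f i).1.
    pose U := \bigcup_i (f i).2.
    have oU : open U by apply: bigcup_open => i _; have [] := fP i.
    have cF n : closed (F n).
      rewrite /F (bigcup_mkord n (fun i => (f i).1)).
      by apply: closed_bigsetU => i _; have [] := fP i.
    have mU := ereal_open_measurable oU.
    have mF n := ereal_closed_measurable (cF n).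
    have mf i : measurable ((f i).2 `\` (f i).1).
      by have [? ? _ _ _] := fP i; apply: measurableD;
        [exact: ereal_open_measurable|exact: ereal_closed_measurable].
    have mD n : measurable (U `\` F n) by exact: measurableD.
    have mI : measurable (\bigcap_n (U `\` F n)).
      by apply: bigcapT_measurable.
    have Ile : (m (\bigcap_n (U `\` F n)) <= (e / 2)%:E)%E.
      apply: le_trans (epsilon_trick0 xpredT (_ : 0 <= e / 2)); last first.
        by rewrite ltW// divr_gt0.
      apply: (@le_trans _ _ (\sum_(i <oo) m ((f i).2 `\` (f i).1))%E); last first.
        by apply: lee_nneseries => // i _; have [] := fP i.
      apply: measure_sigma_subadditive => //.
      move=> x Ix; have [[i _ xi] _] := Ix 0%N I.
      exists i => //; split=> // xf; have [_] := Ix i.+1 I; apply.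
      by exists i => /=.
    have cvg : m (U `\` F n) @[n --> \oo] --> m (\bigcap_n (U `\` F n)).
      apply: nonincreasing_cvg_mu => //; first exact: mFin.
      move=> p q pq; apply/subsetPset; apply: setDS => x [i ip xi].
      by exists i => //; exact: leq_trans pq.
    have [n nP] : exists n, (m (U `\` F n) <= e%:E)%E.
      have : (m (\bigcap_n (U `\` F n)) < e%:E)%E.
        by rewrite (le_lt_trans Ile)// lte_fin; lra.
      move=> /open_ereal_lt'/cvg[n _ /(_ n (leqnn n))] /= mn.
      by exists n; exact: ltW mn.
    exists (F n), U; split=> //.
      by move=> x [i _ xi]; exists i => //; have [_ _ FB _ _] := fP i; exact: FB.
    by move=> x [i _ xi]; exists i => //; have [_ _ _ BU _] := fP i; exact: BU.
- move=> e e0; pose V n := `](r - n.+1%:R^-1)%:E, +oo[%classic : set (\bar R).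
  have cF : closed (`[r%:E, +oo[%classic : set (\bar R)).
    by rewrite set_itvE; exact: closed_ereal_le_ereal.
  have oV n : open (V n) by rewrite /V set_itvE; exact: open_ereal_gt_ereal.
  have FV n : `[r%:E, +oo[%classic `<=` V n.
    move=> x; rewrite /V /= !in_itv /= !andbT; apply: lt_le_trans.
    by rewrite lte_fin ltrBlDr ltrDl invr_gt0.
  pose W n := V n `\` `[r%:E, +oo[%classic.
  have mW n : measurable (W n).
    apply: measurableD; first exact: ereal_open_measurable.
    exact: ereal_closed_measurable.
  have W0 : \bigcap_n W n = set0.
    rewrite -subset0 => x Wx; have [_] := Wx 0%N I; apply.
    rewrite /= in_itv/= andbT; apply/lee_addgt0Pr => d d0.
    have [n nd] : exists n : nat, n.+1%:R^-1 < d.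
      by exists (Num.truncn d^-1); rewrite invf_plt ?posrE// truncnS_gt.
    have [] := Wx n I; rewrite /V/= in_itv/= andbT => + _.
    case: x {Wx} => [x||]//=; last by rewrite leey.
    rewrite lte_fin -EFinD lee_fin -lerBlDr => /ltW rx; apply: le_trans rx.
    by rewrite lerB// ltW.
  have cvg : m (W n) @[n --> \oo] --> m (\bigcap_n W n).
    apply: nonincreasing_cvg_mu => //.
    - exact: mFin.
    - by rewrite W0.
    - move=> p q pq; apply/subsetPset; apply: setSD => x.
      rewrite /V/= !in_itv/= !andbT; apply: le_lt_trans.
      by rewrite lee_fin lerD2l lerN2 lef_pV2 ?posrE// ler_nat.
  have : (m (\bigcap_n W n) < e%:E)%E by rewrite W0 measure0 lte_fin.
  move=> /open_ereal_lt'/cvg[n _ /(_ n (leqnn n))] /= mWn.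
  by exists `[r%:E, +oo[%classic, (V n); split=> //; exact: ltW.
Qed.

End ereal_topology.

(** * Regularity of finite measures *)

(** The classes [inner] and [outer] stand for the compact and the open sets, so
    that one argument serves for both [R] and [\bar R]. *)
Lemma regular_of_squeeze d (T : measurableType d) (R : realType)
    (m : {measure set T -> \bar R}) (inner outer : set (set T)) (A : set T) :
  (m setT < +oo)%E -> measurable A ->
  inner `<=` measurable -> outer `<=` measurable ->
  (forall e : R, 0 < e -> exists K U,
    [/\ inner K, outer U, K `<=` A, A `<=` U & (m (U `\` K) <= e%:E)%E]) ->
  m A = ereal_sup [set m K | K in [set K | inner K /\ K `<=` A]] /\
  m A = ereal_inf [set m U | U in [set U | outer U /\ A `<=` U]].
Proof.
move=> moo mA im om sq.
have mono B C : measurable B -> measurable C -> B `<=` C -> (m B <= m C)%E.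
  by move=> mB mC; apply: le_measure; rewrite inE.
have approx e : 0 < e -> exists K U, [/\ inner K, outer U, K `<=` A, A `<=` U &
    (m U <= m K + e%:E)%E].
  move=> /sq[K [U [iK oU KA AU mUK]]]; exists K, U; split => //.
  have mK := im _ iK; have mU := om _ oU.
  rewrite -(setDUK (subset_trans KA AU)) measureU ?setIDAC ?leeD2l//.
  - exact: measurableD.
  - by rewrite setDE setICA setICr setI0.
split; apply/eqP; rewrite eq_le; apply/andP; split.
- apply/lee_addgt0Pr => e /approx[K [U [iK oU KA AU mUK]]].
  apply: le_trans (mono _ _ mA (om _ oU) AU) _; apply: le_trans mUK _.
  by rewrite leeD2r//; apply: ereal_sup_ubound; exists K.
- by apply: ge_ereal_sup => _ [K [iK KA] <-]; apply: mono => //; exact: im.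
- by apply: le_ereal_inf_tmp => _ [U [oU AU] <-]; apply: mono => //; exact: om.
- apply/lee_addgt0Pr => e /approx[K [U [iK oU KA AU mUK]]].
  apply: (@le_trans _ _ (m U)); first by apply: ereal_inf_lbound; exists U.
  by apply: le_trans mUK _; rewrite leeD2r//; apply: mono => //; exact: im.
Qed.

Section regularity.
Variable R : realType.

Lemma ereal_measure_regular (m : {measure set (\bar R) -> \bar R}) :
  (m setT < +oo)%E ->
  inner_regular (T := \bar R) (@measurable _ (\bar R)) m /\
  outer_regular (T := \bar R) (@measurable _ (\bar R)) m.
Proof.
move=> moo.
have sq A : measurable A ->
    m A = ereal_sup [set m K | K in [set K | compact K /\ K `<=` A]] /\
    m A = ereal_inf [set m U | U in [set U | open U /\ A `<=` U]].
  move=> mA; apply: regular_of_squeeze => //.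
  - move=> K cK; apply: ereal_closed_measurable.
    exact: compact_closed (@ereal_hausdorff R) cK.
  - exact: ereal_open_measurable.
  - move=> e e0.
    have [F [U [cF oU FA AU mUF]]] := ereal_measure_closed_open moo mA e0.
    exists F, U; split => //.
    exact: subclosed_compact cF (@ereal_compact R) _.
by split=> A mA; have [] := sq A mA.
Qed.

Lemma compact_preimage_EFin (K : set (\bar R)) : closed K ->
  ~ K -oo%E -> ~ K +oo%E -> compact (EFin @^-1` K).
Proof.
move=> cK KNy Ky.
have [_ [a [_ aK]]] : (~` K) -oo%E /\ nbhs (-oo%E : \bar R) (~` K).
  by split=> //; apply: open_nbhs_nbhs; split=> //; exact: closed_openC.
have [_ [b [_ bK]]] : (~` K) +oo%E /\ nbhs (+oo%E : \bar R) (~` K).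
  by split=> //; apply: open_nbhs_nbhs; split=> //; exact: closed_openC.
apply: (@subclosed_compact _ _ `[a, b]); last 2 first.
- exact: segment_compact.
- move=> r /= Kr; rewrite in_itv/=; apply/andP; split.
    by rewrite leNgt; apply/negP => ra; apply: (aK r%:E).
  by rewrite leNgt; apply/negP => rb; apply: (bK r%:E).
- by apply: preimage_closed => // r _; exact: EFin_continuous.
Qed.

(** Regularity on [R] is that of the image measure on [\bar R]: a closed set of
    [\bar R] inside [EFin @` A] misses both infinities, so its trace on [R] is
    bounded. *)
Lemma R_measure_regular (m : {measure set R -> \bar R}) :
  (m setT < +oo)%E ->
  inner_regular (T := R) (@measurable _ R) m /\
  outer_regular (T := R) (@measurable _ R) m.
Proof.
move=> moo.
have sq (A : set R) : measurable A ->
    m A = ereal_sup [set m K | K in [set K : set R | compact K /\ K `<=` A]] /\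
    m A = ereal_inf [set m U | U in [set U : set R | open U /\ A `<=` U]].
  move=> mA; apply: (regular_of_squeeze (T := R)) => //.
  - move=> K cK; apply: closed_measurable.
    exact: compact_closed (@Rhausdorff R) cK.
  - exact: open_measurable.
  - move=> e e0.
    pose pm : {measure set (\bar R) -> \bar R} :=
      measure_function_pushforward__canonical__measure_function_Measure m
        (@measurable_EFin R).
    have mEA : measurable (EFin @` A).
      by exists A => //; exists set0; [constructor|rewrite setU0].
    have pmoo : (pm setT < +oo)%E by [].
    have [F [U [cF oU FA AU mUF]]] := ereal_measure_closed_open pmoo mEA e0.
    exists (EFin @^-1` F), (EFin @^-1` U); split => //.
    + by apply: compact_preimage_EFin => //; [move=> /FA[]|move=> /FA[]].
    + by apply: open_comp => // r _; exact: EFin_continuous.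
    + by move=> r /FA[s As [<-]].
    + by move=> r Ar; apply: AU; exists r.
by split=> A mA; have [] := sq A mA.
Qed.

Lemma every_charge_regular (nu : {charge set R -> \bar R}) : regular_charge nu.
Proof.
apply: (R_measure_regular (m := Defs.total_variation nu)).
by rewrite ltey_eq fin_num_measure.
Qed.

Lemma every_echarge_regular (nu : {charge set (\bar R) -> \bar R}) :
  regular_echarge nu.
Proof.
apply: (ereal_measure_regular (m := Defs.total_variation nu)).
by rewrite ltey_eq fin_num_measure.
Qed.

End regularity.

(** * Equivalence of the two forms of the representation *)

Section echarge_integral.
Variable R : realType.

Lemma charge_integral_echarge_of (nu : {charge set R -> \bar R}) (a b : R)
    (f : \bar R -> R) :
  measurable_fun setT f -> [bounded f x | x in setT] ->
  charge_integral (echarge_of nu a b) f =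
  charge_integral nu (f \o EFin) + a * f -oo%E + b * f +oo%E.
Proof.
move=> mf bf; rewrite /echarge_of !charge_integral_cadd//.
rewrite !charge_integral_cscale// !charge_integral_measure//.
rewrite /efin_charge charge_integral_pushforward//.
have dE (c : \bar R) : \int[\d_c]_x f x = f c.
  rewrite /Rintegral integral_dirac//; last exact/measurable_EFinP.
  by rewrite diracE in_setT mul1e.
by rewrite !dE addrA.
Qed.

Lemma clim_ext_continuous n (x : clim R n) (i : 'I_n) :
  continuous (fun t : \bar R => clim_ext x t i 0).
Proof.
have [xc xN xP] := climP x.
have co (F : set_system R) (FF : ProperFilter F) : cvg (x r @[r --> F]) ->
    x r i 0 @[r --> F] --> (lim (x r @[r --> F])) i 0.
  move=> xF; apply: (@cvg_comp _ _ _ x (fun M : 'cV[R]_n => M i 0) F _ _ xF).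
  exact: (@coord_continuous R n 1 i 0).
move=> [r||].
- move=> A /= Ar; rewrite /nbhs/= /fmap/=.
  have := @continuous_comp _ _ _ x (fun M : 'cV[R]_n => M i 0) r (xc r)
    (@coord_continuous R n 1 i 0 _).
  by move=> /(_ A Ar).
- move=> A /= Ar; have /= Anear := co _ _ xP A Ar.
  apply/nbhs_ereal_pinfty; split.
    exact: (@nbhs_singleton R _ A Ar).
  exact: Anear.
- move=> A /= Ar; have /= Anear := co _ _ xN A Ar.
  apply/nbhs_ereal_ninfty; split.
    exact: (@nbhs_singleton R _ A Ar).
  exact: Anear.
Qed.

(** Both forms compare [phi] with the same integrals, and every charge is
    regular. *)
Lemma represents_echarge_of n (phi : clim R n -> R)
    (mu : 'I_n -> {charge set R -> \bar R}) (a1 a2 : 'cV[R]_n) :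
  represents phi mu a1 a2 <->
  erepresents phi (fun i => echarge_of (mu i) (a1 i 0) (a2 i 0)).
Proof.
have E (x : clim R n) :
    vector_charge_integral (fun i => echarge_of (mu i) (a1 i 0) (a2 i 0))
      (clim_ext x) =
    vector_charge_integral mu x + (a1^T *m clim_ext x -oo%E) 0 0
      + (a2^T *m clim_ext x +oo%E) 0 0.
  rewrite /vector_charge_integral !mxE -!big_split/=; apply: eq_bigr => i _.
  have c := @clim_ext_continuous n x i.
  rewrite charge_integral_echarge_of ?mxE//.
  - exact: ereal_continuous_measurable.
  - exact: ereal_continuous_bounded.
split=> -[_ phiE]; split.
- by move=> i; exact: every_echarge_regular.
- by move=> x; rewrite E phiE.
- by move=> i; exact: every_charge_regular.
- by move=> x; rewrite phiE E.
Qed.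

End echarge_integral.

(** * Ramps *)

Section ramp.
Variable R : realType.
Implicit Types (s t r : R) (u : \bar R).

(** The continuous substitute for the indicator of a lower half-line: affine from
    [1] at [s] to [0] at [t]. *)
Definition ramp s t u : R :=
  match u with
  | r%:E => Num.max 0 (Num.min 1 ((t - r) / (t - s)))
  | +oo%E => 0
  | -oo%E => 1
  end.

Lemma ramp_ge0 s t u : 0 <= ramp s t u.
Proof. by case: u => [r||]//=; rewrite le_max lexx. Qed.

Lemma ramp_le1 s t u : ramp s t u <= 1.
Proof. by case: u => [r||]//=; rewrite ge_max ge_min lexx ler01. Qed.

Lemma ramp1 s t u : s < t -> (u <= s%:E)%E -> ramp s t u = 1.
Proof.
move=> st; case: u => [r||]//=; rewrite lee_fin => rs.
rewrite min_l; first by rewrite max_r.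
by rewrite ler_pdivlMr ?subr_gt0// mul1r lerB.
Qed.

Lemma ramp0 s t u : s < t -> (t%:E <= u)%E -> ramp s t u = 0.
Proof.
move=> st; case: u => [r||]//=; rewrite lee_fin => tr.
rewrite max_l// ge_min; apply/orP; right.
by rewrite pmulr_lle0 ?invr_gt0 ?subr_gt0// subr_le0.
Qed.

Lemma ramp_slope s t r : s < t -> s <= r -> r <= t ->
  ramp s t r%:E = (t - r) / (t - s).
Proof.
move=> st sr rt; rewrite /= min_r; last first.
  by rewrite ler_pdivrMr ?subr_gt0// mul1r lerB.
by rewrite max_r// divr_ge0// subr_ge0// ltW.
Qed.

Lemma ramp_le s t s' t' u : s < t -> t <= s' -> s' < t' ->
  ramp s t u <= ramp s' t' u.
Proof.
move=> st ts' s't'; have [us'|s'u] := leP u s'%:E.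
  by rewrite (ramp1 s't' us') ramp_le1.
by rewrite ramp0 ?ramp_ge0// (le_trans _ (ltW s'u))// lee_fin.
Qed.

(** The identity that turns bounds on a ramp into bounds on thinner ramps; it is
    used with iterated halving in place of Riemann sums. *)
Lemma ramp_mid s t u : s < t ->
  ramp s t u = (ramp s ((s + t) / 2) u + ramp ((s + t) / 2) t u) / 2.
Proof.
move=> st; set m := (s + t) / 2.
have sm : s < m by rewrite /m; lra.
have mt : m < t by rewrite /m; lra.
have ts0 : t - s != 0 by rewrite subr_eq0 gt_eqF.
have ms : m - s = (t - s) / 2 by rewrite /m; field.
have tm : t - m = (t - s) / 2 by rewrite /m; field.
have [us|su] := leP u s%:E.
  rewrite !ramp1//; first by field.
  by rewrite (le_trans us)// lee_fin ltW.
have [tu|ut] := leP t%:E u.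
  rewrite !ramp0//; first by field.
  by rewrite (le_trans _ tu)// lee_fin ltW.
case: u su ut => [r||]//; rewrite !lte_fin => sr rt.
rewrite (ramp_slope st (ltW sr) (ltW rt)).
have [rm|mr] := leP r m.
  rewrite (ramp_slope sm (ltW sr) rm) (ramp1 mt) ?lee_fin//.
  by rewrite ms /m; field.
rewrite (ramp0 sm) ?lee_fin ?(ltW mr)// (ramp_slope mt (ltW mr) (ltW rt)).
by rewrite tm; field.
Qed.

Lemma ramp_continuous s t : s < t -> continuous (ramp s t).
Proof.
move=> st [r||].
- suff H : {for r, continuous (ramp s t \o EFin)} by move=> A Ar; exact: (H A Ar).
  apply: (@continuous_max _ _ (fun=> 0 : R^o)); first exact: cvg_cst.
  apply: (@continuous_min _ _ (fun=> 1 : R^o)); first exact: cvg_cst.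
  apply: (@cvgMl _ _ _ _ (fun r => t - r)).
  by apply: cvgB; [exact: cvg_cst|exact: cvg_id].
- move=> A /= A0; apply/nbhs_ereal_pinfty; split; first exact: (nbhs_singleton A0).
  exists t; split; rewrite ?num_real// => r tr /=.
  rewrite -/(ramp s t r%:E) ramp0 ?lee_fin ?(ltW tr)//; exact: (nbhs_singleton A0).
- move=> A /= A1; apply/nbhs_ereal_ninfty; split; first exact: (nbhs_singleton A1).
  exists s; split; rewrite ?num_real// => r rs /=.
  rewrite -/(ramp s t r%:E) ramp1 ?lee_fin ?(ltW rs)//; exact: (nbhs_singleton A1).
Qed.

End ramp.
Arguments ramp : simpl never.

Lemma Rintegral_between d (T : measurableType d) (R : realType)
    (m : {measure set T -> \bar R}) (A B : set T) (h : T -> R) :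
  (m setT < +oo)%E -> measurable A -> measurable B -> measurable_fun setT h ->
  (forall x, 0 <= h x <= 1) -> (forall x, A x -> h x = 1) ->
  (forall x, ~ B x -> h x = 0) ->
  fine (m A) <= \int[m]_x h x <= fine (m B).
Proof.
move=> moo mA mB mh h01 hA hB.
have bnd (g : T -> R) : (forall x, 0 <= g x <= 1) -> [bounded g x | x in setT].
  move=> g01; exists 1; split => // N N1 x _ /=.
  by have /andP[g0 g1] := g01 x; rewrite ger0_norm// (le_trans g1)// ltW.
have indic01 (C : set T) x : 0 <= (\1_C x : R) <= 1.
  by rewrite indicE; case: (_ \in _); rewrite ?lexx ler01.
have Ih : m.-integrable setT (EFin \o h).
  by apply: measurable_bounded_integrable => //; exact: bnd.
have I1 C : measurable C -> m.-integrable setT (EFin \o (\1_C : T -> R)).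
  by move=> mC; apply: measurable_bounded_integrable => //; exact: bnd.
have E C : measurable C -> fine (m C) = \int[m]_x (\1_C x).
  by move=> mC; rewrite /Rintegral integral_indic// setIT.
rewrite (E _ mA) (E _ mB); apply/andP; split; apply: le_Rintegral => //.
- exact: I1.
- move=> x _; rewrite indicE; have [/set_mem/hA ->//|_] := boolP (x \in A).
  by have /andP[] := h01 x.
- exact: I1.
- move=> x _; rewrite indicE; have [_|/negP xB] := boolP (x \in B).
    by have /andP[] := h01 x.
  by rewrite hB// => /mem_set.
Qed.

(** The rays [`]r, +oo]] are stable under intersection and generate the Borel
    sets; the full space is added to the generators because the rays do not
    cover [-oo]. *)
Lemma cdf_unique (R : realType) (m1 m2 : {measure set (\bar R) -> \bar R}) :
  (m1 setT < +oo)%E -> m1 setT = m2 setT ->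
  (forall t : R, m1 [set u | u <= t%:E]%E = m2 [set u | u <= t%:E]%E) ->
  forall A, measurable A -> m1 A = m2 A.
Proof.
move=> m1oo m12 m1m2 A mA.
have m2oo : (m2 setT < +oo)%E by rewrite -m12.
pose G := [set B : set (\bar R) |
  B = setT \/ exists r : R, B = `]r%:E, +oo[%classic].
apply: (@g_sigma_algebra_measure_unique _ R _ G _ (fun=> setT)) => //.
- by move=> B [->|[r ->]]; [exact: measurableT|exact: emeasurable_itv].
- by move=> _; left.
- by rewrite bigcup_const.
- move=> B C [->|[r ->]] [->|[s ->]]; rewrite ?setTI ?setIT; [by left|..].
  + by right; exists s.
  + by right; exists r.
  + right; exists (Num.max r s).
    by apply/seteqP; split=> [u|u]/=;
      rewrite !in_itv/= !andbT EFin_max gt_max => /andP.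
- move=> B [->//|[r ->]].
  have mr : measurable [set u : \bar R | u <= r%:E]%E.
    by rewrite -set_itvNyc; exact: emeasurable_itv.
  rewrite (_ : `]r%:E, +oo[%classic = setT `\` [set u | u <= r%:E]%E); last first.
    apply/seteqP; split=> u /=; rewrite in_itv/= andbT.
      by move=> ru; split=> //; apply/negP; rewrite -ltNge.
    by move=> [_ /negP]; rewrite -ltNge.
  have mD (m : {measure set (\bar R) -> \bar R}) : (m setT < +oo)%E ->
      m (setT `\` [set u | u <= r%:E]%E) = (m setT - m [set u | u <= r%:E]%E)%E.
    by move=> moo; rewrite measureD// setTI.
  by rewrite !mD// m12 m1m2.
- suff : @measurable _ (\bar R) `<=` <<s G>> by apply.
  rewrite [measurable](ErealGenOInfty.measurableE R).
  apply: sub_smallest2r => [|_ [r ->]]; first exact: smallest_sigma_algebra.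
  by right; exists r.
Qed.

(** * Uniqueness of a charge with given integrals *)

Section uniqueness.
Variable R : realType.

Let Iic (t : R) : set (\bar R) := [set u | u <= t%:E]%E.

Let mIic t : measurable (Iic t).
Proof. by rewrite /Iic -set_itvNyc; exact: emeasurable_itv. Qed.

Lemma Rintegral_ramp_between (m : {measure set (\bar R) -> \bar R}) (s t : R) :
  (m setT < +oo)%E -> s < t ->
  fine (m [set u | u <= s%:E]%E) <= \int[m]_u ramp s t u
    <= fine (m [set u | u <= t%:E]%E).
Proof.
move=> moo st; apply: Rintegral_between => //.
- exact: mIic.
- exact: mIic.
- exact/ereal_continuous_measurable/ramp_continuous.
- by move=> u; rewrite ramp_ge0 ramp_le1.
- by move=> u; exact: ramp1.
- by move=> u /negP; rewrite -ltNge => /ltW; exact: ramp0.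
Qed.

(** For [t < s], the integral of [ramp t s], common to both measures, is at least
    [m [-oo, t]] and at most [m' [-oo, s]]; letting [s] decrease to [t] compares
    the two distribution functions. *)
Lemma measure_unique_continuous (m1 m2 : {measure set (\bar R) -> \bar R}) :
  (m1 setT < +oo)%E -> (m2 setT < +oo)%E ->
  (forall f : \bar R -> R, continuous f -> \int[m1]_u f u = \int[m2]_u f u) ->
  forall A, measurable A -> m1 A = m2 A.
Proof.
move=> m1oo m2oo m12.
have fin (m : {measure set (\bar R) -> \bar R}) A :
    (m setT < +oo)%E -> measurable A -> m A \is a fin_num.
  move=> moo mA; rewrite ge0_fin_numE//; apply: le_lt_trans moo.
  by apply: le_measure => //; rewrite inE.
have le (m m' : {measure set (\bar R) -> \bar R}) t :
    (m setT < +oo)%E -> (m' setT < +oo)%E ->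
    (forall f : \bar R -> R, continuous f -> \int[m]_u f u = \int[m']_u f u) ->
    (m (Iic t) <= m' (Iic t))%E.
  move=> moo m'oo mm'; pose F n := Iic (t + n.+1%:R^-1).
  have FE : \bigcap_n F n = Iic t.
    apply/seteqP; split=> [u Fu|u ut n _]; last first.
      by apply: le_trans ut _; rewrite lee_fin lerDl.
    apply/lee_addgt0Pr => d d0.
    have [n nd] : exists n : nat, n.+1%:R^-1 < d.
      by exists (Num.truncn d^-1); rewrite invf_plt ?posrE// truncnS_gt.
    by apply: le_trans (Fu n I) _; rewrite -EFinD lee_fin lerD2l ltW.
  have : m' (F n) @[n --> \oo] --> m' (\bigcap_n F n).
    apply: nonincreasing_cvg_mu => //.
    - by rewrite ltey_eq fin ?orbT//; exact: mIic.
    - by move=> n; exact: mIic.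
    - by rewrite FE; exact: mIic.
    - move=> p q pq; apply/subsetPset => u; move/le_trans; apply.
      by rewrite lee_fin lerD2l lef_pV2 ?posrE// ler_nat.
  rewrite FE => /cvge_to_ge; apply; apply: nearW => n.
  rewrite -(fineK (fin _ _ moo (mIic t))).
  rewrite -(fineK (fin _ _ m'oo (mIic (t + n.+1%:R^-1)))).
  have tn : t < t + n.+1%:R^-1 by rewrite ltrDl.
  have /andP[le1 _] := Rintegral_ramp_between moo tn.
  have /andP[_ le2] := Rintegral_ramp_between m'oo tn.
  rewrite lee_fin (le_trans le1)// mm'//; exact: ramp_continuous.
apply: cdf_unique => //.
- have := m12 _ (@cst_continuous _ _ (1 : R)); rewrite !Rintegral_cst// !mul1r => E.
  by rewrite -(fineK (fin _ _ m1oo measurableT)) E fineK// fin.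
- by move=> t; apply/eqP; rewrite eq_le !le// => f cf; rewrite m12.
Qed.

Lemma charge_unique_continuous (nu nu' : {charge set (\bar R) -> \bar R}) :
  (forall f : \bar R -> R, continuous f ->
     charge_integral nu f = charge_integral nu' f) ->
  forall A, measurable A -> nu A = nu' A.
Proof.
move=> nn' A mA.
have swap (a b a' b' : R) : a - b = a' - b' -> a + b' = a' + b.
  by move=> h; lra.
have oo (m : {finite_measure set (\bar R) -> \bar R}) : (m setT < +oo)%E.
  by rewrite ltey_eq fin_num_measure.
pose m1 := measure_add (positive_variation nu) (negative_variation nu').
pose m2 := measure_add (positive_variation nu') (negative_variation nu).
have m1oo : (m1 setT < +oo)%E by rewrite /m1 measure_addE lte_add_pinfty ?oo.
have m2oo : (m2 setT < +oo)%E by rewrite /m2 measure_addE lte_add_pinfty ?oo.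
have : m1 A = m2 A.
  apply: (measure_unique_continuous m1oo m2oo) => // f cf.
  have mf := ereal_continuous_measurable cf.
  have bf := ereal_continuous_bounded cf.
  rewrite /m1 /m2 !Rintegral_measure_add ?oo//.
  by apply: swap; exact: nn'.
have -> : m1 A = (positive_variation nu A + negative_variation nu' A)%E.
  exact: measure_addE.
have -> : m2 A = (positive_variation nu' A + negative_variation nu A)%E.
  exact: measure_addE.
rewrite (jordan_variationE nu mA) (jordan_variationE nu' mA).
have fn (m : {finite_measure set (\bar R) -> \bar R}) : m A \is a fin_num.
  exact: fin_num_measure.
have swape (a b a' b' : \bar R) : a \is a fin_num -> b \is a fin_num ->
    a' \is a fin_num -> b' \is a fin_num ->
    (a + b' = a' + b -> a - b = a' - b')%E.
  case: a b a' b' => [a||] [b||] [a'||] [b'||]//= _ _ _ _ [h].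
  by congr EFin; lra.
by apply: swape; exact: fn.
Qed.

End uniqueness.

(** * Stieltjes measure of a bounded distribution function *)

Section stieltjes.
Variables (R : realType) (F : cumulative R R).

(** The Lebesgue-Stieltjes measure of [F], as a measure on [R] itself rather than
    on the copy of [R] whose measurable structure is generated by the half-open
    intervals. *)
Definition stieltjes : set R -> \bar R := lebesgue_stieltjes_measure F.

Let stieltjes0 : stieltjes set0 = 0%E.
Proof. exact: (measure0 (lebesgue_stieltjes_measure F)). Qed.

Let stieltjes_ge0 A : (0 <= stieltjes A)%E.
Proof. exact: (measure_ge0 (lebesgue_stieltjes_measure F)). Qed.

Let stieltjes_additive : semi_sigma_additive stieltjes.
Proof.
exact: (@measure_semi_sigma_additive _ _ _ (lebesgue_stieltjes_measure F)).
Qed.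

HB.instance Definition _ := isMeasure.Build default_measure_display R R stieltjes
  stieltjes0 stieltjes_ge0 stieltjes_additive.

Lemma stieltjes_itvoc (a b : R) : a <= b -> stieltjes `]a, b] = (F b - F a)%:E.
Proof.
move=> ab; rewrite /stieltjes /lebesgue_stieltjes_measure /measure_extension/=.
rewrite measurable_mu_extE/=; last exact: is_ocitv.
by rewrite wlength_itv_bnd// EFinB.
Qed.

Hypotheses (Flb : has_lbound (range F)) (Fub : has_ubound (range F)).

Let Fnd := cumulative_is_nondecreasing F.

Let F_Ny : F (- n%:R) @[n --> \oo] --> inf (range F).
Proof.
suff -> : inf (range F) = inf (range (fun n : nat => F (- n%:R))).
  apply: nonincreasing_cvgn.
    by move=> p q pq; apply: Fnd; rewrite lerN2 ler_nat.
  by have [l lF] := Flb; exists l => _ [n _ <-]; apply: lF; exists (- n%:R).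
apply/eqP; rewrite eq_le; apply/andP; split.
  apply: lb_le_inf; first by exists (F (- 0%:R)); exists 0%N.
  by move=> _ [n _ <-]; apply: ge_inf => //; exists (- n%:R).
apply: lb_le_inf; first by exists (F 0); exists 0.
move=> _ [r _ <-]; apply: (@le_trans _ _ (F (- (Num.truncn (- r)).+1%:R))).
  apply: ge_inf; last by exists (Num.truncn (- r)).+1.
  by have [l lF] := Flb; exists l => _ [n _ <-]; apply: lF; exists (- n%:R).
by apply: Fnd; rewrite lerNl ltW// truncnS_gt.
Qed.

Let F_y : F n%:R @[n --> \oo] --> sup (range F).
Proof.
suff -> : sup (range F) = sup (range (fun n : nat => F n%:R)).
  apply: nondecreasing_cvgn.
    by move=> p q pq; apply: Fnd; rewrite ler_nat.
  by have [l lF] := Fub; exists l => _ [n _ <-]; apply: lF; exists n%:R.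
apply/eqP; rewrite eq_le; apply/andP; split; last first.
  apply: ge_sup; first by exists (F 0%:R); exists 0%N.
  by move=> _ [n _ <-]; apply: ub_le_sup => //; exists n%:R.
apply: ge_sup; first by exists (F 0); exists 0.
move=> _ [r _ <-]; apply: (@le_trans _ _ (F (Num.truncn r).+1%:R)).
  by apply: Fnd; rewrite ltW// truncnS_gt.
apply: ub_le_sup; last by exists (Num.truncn r).+1.
by have [l lF] := Fub; exists l => _ [n _ <-]; apply: lF; exists n%:R.
Qed.

Lemma stieltjes_itvNyc (t : R) : stieltjes `]-oo, t] = (F t - inf (range F))%:E.
Proof.
rewrite itvNybndEbigcup.
have h1 : stieltjes `]- n%:R, t] @[n --> \oo] --> (F t - inf (range F))%:E.
  apply: cvg_trans (_ : (F t - F (- n%:R))%:E @[n --> \oo] --> _).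
    apply: near_eq_cvg; near=> n; rewrite stieltjes_itvoc// lerNl.
    by near: n; exact: nbhs_infty_ger.
  by apply: cvg_EFin; [exact: nearW|apply: cvgB; [exact: cvg_cst|exact: F_Ny]].
have h2 : stieltjes `]- n%:R, t] @[n --> \oo] -->
    stieltjes (\bigcup_n `](- n%:R)%R, t]%classic).
  apply: nondecreasing_cvg_mu => //; first exact: bigcup_measurable.
  by move=> p q pq; apply/subsetPset/subset_itv; rewrite leBSide//= lerN2 ler_nat.
exact: cvg_unique h2 h1.
Unshelve. all: by end_near. Qed.

Lemma stieltjes_setT : stieltjes setT = (sup (range F) - inf (range F))%:E.
Proof.
rewrite [X in stieltjes X](_ : _ = \bigcup_n `]-oo, n%:R]%classic); last first.
  apply/esym; rewrite -subTset => r _; exists (Num.truncn r).+1 => //=.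
  by rewrite in_itv/= ltW// truncnS_gt.
have h1 : stieltjes `]-oo, n%:R] @[n --> \oo] --> (sup (range F) - inf (range F))%:E.
  under eq_fun do rewrite stieltjes_itvNyc.
  by apply: cvg_EFin; [exact: nearW|apply: cvgB; [exact: F_y|exact: cvg_cst]].
have h2 : stieltjes `]-oo, n%:R] @[n --> \oo] -->
    stieltjes (\bigcup_n `]-oo, n%:R]%classic).
  apply: nondecreasing_cvg_mu => //; first exact: bigcup_measurable.
  by move=> p q pq; apply/subsetPset/subset_itvl; rewrite leBSide/= ler_nat.
exact: cvg_unique h2 h1.
Qed.

Lemma stieltjes_finite : fin_num_fun stieltjes.
Proof.
move=> A mA; rewrite ge0_fin_numE ?measure_ge0//.
apply: (@le_lt_trans _ _ (stieltjes setT)).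
  by apply: le_measure => //; rewrite inE.
by rewrite stieltjes_setT ltry.
Qed.

End stieltjes.

Lemma bounded_cumulative_measure (R : realType) (F : cumulative R R) :
  has_lbound (range F) -> has_ubound (range F) ->
  exists mu : {finite_measure set R -> \bar R},
    (forall t, mu `]-oo, t]%classic = (F t - inf (range F))%:E) /\
    mu setT = (sup (range F) - inf (range F))%:E.
Proof.
move=> Flb Fub.
pose fin := Measure_isFinite.Build _ _ _ (stieltjes F) (stieltjes_finite Flb Fub).
pose mu : {finite_measure set R -> \bar R} := HB.pack (stieltjes F) fin.
exists mu; split; first exact: stieltjes_itvNyc.
exact: stieltjes_setT.
Qed.

(** * Positive functionals *)

(** Only additivity on nonnegative continuous functions is asked of [L], which is
    what the positive part of a functional offers directly. *)
Section positive_functional.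
Variables (R : realType) (L : (\bar R -> R) -> R).
Hypothesis LD : forall f g : \bar R -> R, continuous f -> continuous g ->
  (forall u, 0 <= f u) -> (forall u, 0 <= g u) -> L (f \+ g) = L f + L g.
Hypothesis L_ge0 : forall f : \bar R -> R, continuous f -> (forall u, 0 <= f u) ->
  0 <= L f.

Let le_L (f g : \bar R -> R) : continuous f -> continuous g ->
  (forall u, 0 <= f u <= g u) -> L f <= L g.
Proof.
move=> cf cg fg; have cgf : continuous (g \- f).
  by move=> u; apply: cvgB; [exact: cg|exact: cf].
have -> : g = f \+ (g \- f) by apply/funext => u /=; rewrite subrKC.
have f0 u : 0 <= f u by have /andP[] := fg u.
have gf0 u : 0 <= (g \- f) u by rewrite subr_ge0; have /andP[] := fg u.
by rewrite LD// lerDl; exact: L_ge0.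
Qed.

Let Lramp_mid (s t : R) : s < t ->
  L (ramp s t) = (L (ramp s ((s + t) / 2)) + L (ramp ((s + t) / 2) t)) / 2.
Proof.
move=> st; have sm : s < (s + t) / 2 by lra.
have mt : (s + t) / 2 < t by lra.
have cst := ramp_continuous st.
have L2 : L (ramp s t) + L (ramp s t) =
    L (ramp s ((s + t) / 2)) + L (ramp ((s + t) / 2) t).
  rewrite -!LD//; try exact: ramp_continuous; try by move=> u; exact: ramp_ge0.
  by congr L; apply/funext => u /=; rewrite (ramp_mid u st); field.
by rewrite -L2; field.
Qed.

Let Lramp_ge0 (s t : R) : s < t -> 0 <= L (ramp s t).
Proof.
by move=> st; apply: L_ge0 => [|u]; [exact: ramp_continuous|exact: ramp_ge0].
Qed.

Let Lramp_le1 (s t : R) : s < t -> L (ramp s t) <= L (fun=> 1).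
Proof.
move=> st; apply: le_L; [exact: ramp_continuous|exact: cst_continuous|].
by move=> u; rewrite ramp_ge0 ramp_le1.
Qed.

Let above (t : R) := [set L (ramp p.1 p.2) | p in [set p : R * R | t < p.1 < p.2]].

(** With both ends of the ramp strictly to the right of [t], right continuity is
    immediate: a ramp that nearly achieves the infimum at [t] also competes at
    points slightly larger than [t]. *)
Definition functional_cdf (t : R) : R := inf (above t).

Let has_inf_above t : has_inf (above t).
Proof.
split; first by exists (L (ramp (t + 1) (t + 2))), (t + 1, t + 2) => //=; lra.
exists 0 => _ [[s s'] /= /andP[ts ss'] <-]; exact: Lramp_ge0.
Qed.

Let cdf_le_ramp t s s' : t < s -> s < s' -> functional_cdf t <= L (ramp s s').
Proof.
move=> ts ss'; apply: ge_inf; first by have [] := has_inf_above t.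
by exists (s, s') => //=; rewrite ts ss'.
Qed.

Let ramp_le_cdf s t : s < t -> L (ramp s t) <= functional_cdf t.
Proof.
move=> st; apply: lb_le_inf; first by have [] := has_inf_above t.
move=> _ [[p q] /= /andP[tp pq] <-].
apply: le_L; try exact: ramp_continuous.
by move=> u; rewrite ramp_ge0 ramp_le// ltW.
Qed.

Let cdf_nd : nondecreasing functional_cdf.
Proof.
move=> s t; rewrite le_eqVlt => /predU1P[->//|st].
have sm : s < (s + t) / 2 by lra.
have mt : (s + t) / 2 < t by lra.
exact: le_trans (cdf_le_ramp sm mt) (ramp_le_cdf mt).
Qed.

Let cdf_ge0 t : 0 <= functional_cdf t.
Proof.
have tt1 : t - 1 < t by lra.
exact: le_trans (Lramp_ge0 tt1) (ramp_le_cdf tt1).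
Qed.

Let cdf_le1 t : functional_cdf t <= L (fun=> 1).
Proof.
have tt1 : t < t + 1 by lra.
have t12 : t + 1 < t + 2 by lra.
exact: le_trans (cdf_le_ramp tt1 t12) (Lramp_le1 t12).
Qed.

Let cdf_rc : right_continuous functional_cdf.
Proof.
move=> t; apply/cvgrPdist_le => e e0.
have [_ [[s s'] /= /andP[ts ss'] <-] se] := inf_adherent e0 (has_inf_above t).
near=> r; have tr : t < r by near: r; exact: nbhs_right_gt.
have rs : r < s by near: r; exact: nbhs_right_lt.
have := cdf_le_ramp rs ss'; have := cdf_nd (ltW tr).
move: se; rewrite -/(functional_cdf t) => *; rewrite ler_norml; lra.
Unshelve. all: by end_near. Qed.

(* [cdf_le_ramp] leaves out a ramp that starts at [s] itself.  After halving it
   [k] times towards [s], every piece but the first, of weight [2 ^- k], starts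
   strictly to the right of [s]. *)
Let cdf_le_ramp_left s t : s < t -> functional_cdf s <= L (ramp s t).
Proof.
move=> st.
have H k t' : s < t' -> (1 - 2^-1 ^+ k) * functional_cdf s <= L (ramp s t').
  elim: k t' => [|k IH] t' st'.
    by rewrite expr0 subrr mul0r Lramp_ge0.
  have sm : s < (s + t') / 2 by lra.
  have mt : (s + t') / 2 < t' by lra.
  rewrite Lramp_mid//; have := IH _ sm; have := cdf_le_ramp sm mt.
  by rewrite exprS; set z := 2^-1 ^+ k; lra.
have : (1 - 2^-1 ^+ k) * functional_cdf s @[k --> \oo] --> (1 - 0) * functional_cdf s.
  apply: cvgMl; apply: cvgB; first exact: cvg_cst.
  by apply: cvg_expr; rewrite ger0_norm; lra.
rewrite subr0 mul1r => /cvgr_to_le; apply; apply: nearW => k; exact: H.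
Qed.

(** The measure is the Stieltjes measure of the distribution function [F] of [L];
    [inf F] is the mass left at [-oo] and [L 1 - sup F] the mass left at [+oo].
    On [ramp s t] both [L] and the integral lie between [F s] and [F t], and both
    satisfy the midpoint identity, so their difference is at most
    [2 ^- k * (F t - F s)] for all [k]. *)
Lemma positive_functional_ramp :
  exists (mu : {finite_measure set R -> \bar R}) (a b : R),
    L (fun=> 1) = \int[mu]_r 1 + a + b /\
    forall s t, s < t -> L (ramp s t) = \int[mu]_r ramp s t r%:E + a.
Proof.
pose F : cumulative R R :=
  HB.pack functional_cdf (isCumulative.Build R _ R functional_cdf cdf_nd cdf_rc).
have Flb : has_lbound (range F) by exists 0 => _ [r _ <-]; exact: cdf_ge0.
have Fub : has_ubound (range F) by exists (L (fun=> 1)) => _ [r _ <-]; exact: cdf_le1.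
have [mu [muNy muT]] := bounded_cumulative_measure Flb Fub.
exists mu, (inf (range F)), (L (fun=> 1) - sup (range F)); split.
  rewrite Rintegral_cst// mul1r.
  have -> : fine (mu setT) = sup (range F) - inf (range F) by rewrite muT.
  by rewrite subrK subrKC.
have muoo : (mu setT < +oo)%E by rewrite muT ltry.
have mramp p q : p < q -> measurable_fun setT (fun r : R => ramp p q r%:E).
  move=> pq; have mr := ereal_continuous_measurable (ramp_continuous pq).
  exact: measurableT_comp mr (@measurable_EFin R).
pose I s t := \int[mu]_r ramp s t r%:E + inf (range F).
have I_between s t : s < t -> F s <= I s t <= F t.
  move=> st.
  have : fine (mu `]-oo, s]%classic) <= \int[mu]_r ramp s t r%:E
      <= fine (mu `]-oo, t]%classic).
    apply: Rintegral_between => //.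
    - exact: mramp.
    - by move=> r; rewrite ramp_ge0 ramp_le1.
    - by move=> r /=; rewrite in_itv/= => rs; apply: ramp1; rewrite ?lee_fin.
    - move=> r /=; rewrite in_itv/= => /negP; rewrite -ltNge => /ltW tr.
      by apply: ramp0; rewrite ?lee_fin.
  by rewrite !muNy /= /I; lra.
have I_mid s t : s < t -> I s t = (I s ((s + t) / 2) + I ((s + t) / 2) t) / 2.
  move=> st; have sm : s < (s + t) / 2 by lra.
  have mt : (s + t) / 2 < t by lra.
  have Ir p q : p < q -> mu.-integrable setT (EFin \o (fun r => ramp p q r%:E)).
    move=> pq; apply: measurable_bounded_integrable => //; first exact: mramp.
    exists 1; split => // N N1 r _ /=.
    by rewrite ger0_norm ?ramp_ge0// (le_trans (ramp_le1 _ _ _))// ltW.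
  rewrite /I; set J := \int[mu]_r ramp s t r%:E.
  suff : J + J = \int[mu]_r ramp s ((s + t) / 2) r%:E +
    \int[mu]_r ramp ((s + t) / 2) t r%:E by lra.
  rewrite -!RintegralD//; try exact: Ir.
  by apply: eq_Rintegral => r _ ; rewrite (ramp_mid _ st); field.
have D k s t : s < t -> `|L (ramp s t) - I s t| <= 2^-1 ^+ k * (F t - F s).
  elim: k s t => [|k IH] s t st.
    have := I_between _ _ st; have := cdf_le_ramp_left st; have := ramp_le_cdf st.
    rewrite expr0 mul1r ler_norml -/(F s) -/(F t); lra.
  have sm : s < (s + t) / 2 by lra.
  have mt : (s + t) / 2 < t by lra.
  rewrite Lramp_mid// I_mid//; have := IH _ _ sm; have := IH _ _ mt.
  rewrite exprS; set z := 2^-1 ^+ k; rewrite !ler_norml; lra.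
move=> s t st; apply/eqP; rewrite -subr_eq0 -normr_le0.
have : 2^-1 ^+ k * (F t - F s) @[k --> \oo] --> 0 * (F t - F s).
  by apply: cvgMl; apply: cvg_expr; rewrite ger0_norm; lra.
rewrite mul0r => /cvgr_to_ge; apply; apply: nearW => k; exact: D.
Qed.

End positive_functional.

(** * Density of ramps and continuity of the integral *)

Section approximation.
Variables (R : realType) (V : (\bar R -> R) -> Prop).
Hypothesis V_cst : forall a : R, V (fun=> a).
Hypothesis V_step : forall (g : \bar R -> R) (a s t : R), s < t -> V g ->
  V (fun u => g u + a * (1 - ramp s t u)).

(** The approximation is built from left to right.  [Q x] says that some [g] in [V]
    is [e]-close to [f] up to [x] and constant, equal to [f x], from [x] on.  It
    holds near [-oo]; a ramp across an interval on which [f] varies little moves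
    it to the right, so by continuity of [f] at a hypothetical finite supremum,
    [Q] holds arbitrarily far to the right, where [f] is nearly constant. *)
Lemma ramp_approximation (f : \bar R -> R) (e : R) : continuous f -> 0 < e ->
  exists2 g, V g & forall u, `|f u - g u| <= e.
Proof.
move=> cf e0; have e20 : 0 < e / 2 by rewrite divr_gt0.
pose Q (x : R) := exists g, [/\ V g, forall u, (u <= x%:E)%E -> `|f u - g u| <= e &
  forall u, (x%:E <= u)%E -> g u = f x%:E].
have Qstep x y : x < y ->
    (forall u, (x%:E <= u <= y%:E)%E -> `|f u - f x%:E| <= e / 2) -> Q x -> Q y.
  move=> xy osc [g [Vg gle gge]].
  exists (fun u => g u + (f y%:E - f x%:E) * (1 - ramp x y u)).
  split; first exact: V_step.
  - move=> u uy; have [ux|xu] := leP u x%:E.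
      by rewrite ramp1// subrr mulr0 addr0; exact: gle.
    rewrite (gge _ (ltW xu)).
    have /osc ou : (x%:E <= u <= y%:E)%E by rewrite (ltW xu).
    have /osc oy : (x%:E <= y%:E <= y%:E)%E by rewrite lee_fin (ltW xy)/=.
    have := ramp_ge0 x y u; have := ramp_le1 x y u; set z := ramp x y u => z1 z0.
    have zz : `|(f y%:E - f x%:E) * (1 - z)| <= e / 2.
      rewrite normrM (ger0_norm (_ : 0 <= 1 - z)) ?subr_ge0//.
      by rewrite (le_trans _ oy)// ler_piMr// gerBl.
    rewrite opprD addrA; apply: le_trans (ler_normB _ _) _.
    by rewrite (splitr e) lerD.
  - move=> u yu; rewrite (ramp0 xy yu) subr0 mulr1 gge ?subrKC//.
    by rewrite (le_trans _ yu)// lee_fin ltW.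
have osc_near (u : \bar R) : \forall v \near u, `|f v - f u| <= e / 4.
  have e40 : 0 < e / 4 by rewrite divr_gt0.
  have /cvgrPdist_le/(_ _ e40) := cf u.
  by apply: filterS => v; rewrite distrC.
have [A QA] : exists A, Q A.
  have [M [_ MP]] := osc_near -oo%E.
  exists (M - 1), (fun=> f (M - 1)%:E); split=> // u uM.
  have h1 : `|f u - f -oo%E| <= e / 4.
    by apply: MP; apply: le_lt_trans uM _; rewrite lte_fin; lra.
  have h2 : `|f (M - 1)%:E - f -oo%E| <= e / 4.
    by apply: MP; rewrite lte_fin; lra.
  by move: h1 h2; rewrite !ler_norml; lra.
have [B [_ BP]] := osc_near +oo%E.
suff [x [g [Vg gle gge]] Bx] : exists2 x, Q x & B < x.
  exists g => // u; have [ux|/ltW xu] := leP u x%:E; first exact: gle.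
  rewrite gge//.
  have h1 : `|f u - f +oo%E| <= e / 4.
    by apply: BP; apply: lt_le_trans xu; rewrite lte_fin.
  have h2 : `|f x%:E - f +oo%E| <= e / 4 by apply: BP; rewrite lte_fin.
  by move: h1 h2; rewrite !ler_norml; lra.
apply: contrapT => noQ.
have QB x : Q x -> x <= B.
  by move=> Qx; rewrite leNgt; apply/negP => Bx; apply: noQ; exists x.
have Qsup : has_sup Q by split; [exists A|exists B].
have [d /= d0 dP] := osc_near (sup Q)%:E.
have [x Qx dx] := sup_adherent d0 Qsup.
have xs : x <= sup Q by apply: ub_le_sup => //; exists B.
have close v : x <= v -> v <= sup Q + d / 2 -> `|f v%:E - f (sup Q)%:E| <= e / 4.
  by move=> xv vs; apply: (dP v); rewrite /= ltr_norml; lra.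
have : Q (sup Q + d / 2).
  apply: Qstep Qx; first by lra.
  move=> [v||] /andP[]; rewrite ?leey// ?lee_fin// => xv vs.
  have := close v xv vs; have := close x (lexx x) (le_trans xv vs).
  by rewrite !ler_norml; lra.
have sQ : has_ubound Q by exists B.
by move=> /(ub_le_sup sQ); lra.
Qed.

End approximation.

Section affine_integral.
Variable R : realType.
Variables (mu : {finite_measure set R -> \bar R}) (a b : R).

Definition extended_integral (f : \bar R -> R) : R :=
  \int[mu]_r f r%:E + a * f -oo%E + b * f +oo%E.

Let integrable_fin (f : \bar R -> R) : continuous f ->
  mu.-integrable setT (EFin \o (fun r => f r%:E)).
Proof.
move=> cf; apply: measurable_bounded_integrable => //.
- by rewrite ltey_eq fin_num_measure.
- exact: measurableT_comp (ereal_continuous_measurable cf) (@measurable_EFin R).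
- have [M [Mr Mb]] := ereal_continuous_bounded cf.
  by exists M; split=> // N MN r _; exact: (Mb N MN r%:E).
Qed.

Lemma extended_integralZD (c : R) (f g : \bar R -> R) : continuous f -> continuous g ->
  extended_integral (fun u => c * f u + g u) =
  c * extended_integral f + extended_integral g.
Proof.
move=> cf cg; rewrite /extended_integral.
have If := integrable_fin cf; have Ig := integrable_fin cg.
have Icf : mu.-integrable setT (EFin \o (fun r => c * f r%:E)).
  apply: integrable_fin (fun u => c * f u) _ => u.
  by apply: cvgMr; exact: cf.
rewrite RintegralD// RintegralZl//; lra.
Qed.

Lemma extended_integral_bound (f : \bar R -> R) (M : R) : continuous f ->
  (forall u, `|f u| <= M) ->
  `|extended_integral f| <= (fine (mu setT) + `|a| + `|b|) * M.
Proof.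
move=> cf fM; have If := integrable_fin cf.
have hmu : `|\int[mu]_r f r%:E| <= fine (mu setT) * M.
  apply: le_trans (le_normr_Rintegral measurableT If) _.
  rewrite mulrC -Rintegral_cst//; apply: le_Rintegral => //.
  - exact: integrable_norm.
  - by apply: (integrable_fin (f := fun=> M)); exact: cst_continuous.
have ha : `|a * f -oo%E| <= `|a| * M by rewrite normrM ler_wpM2l.
have hb : `|b * f +oo%E| <= `|b| * M by rewrite normrM ler_wpM2l.
rewrite /extended_integral !mulrDl.
by apply: le_trans (ler_normD _ _) _; rewrite lerD// (le_trans (ler_normD _ _))// lerD.
Qed.

End affine_integral.

(** * Bounded functionals on scalar functions *)

Section bounded_functional.
Variables (R : realType) (psi : (\bar R -> R) -> R) (C : R).
Hypothesis psiZD : forall (c : R) (f g : \bar R -> R), continuous f -> continuous g ->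
  psi (fun u => c * f u + g u) = c * psi f + psi g.
Hypothesis psi_bound : forall (f : \bar R -> R) (M : R), continuous f ->
  (forall u, `|f u| <= M) -> `|psi f| <= C * M.

Implicit Types f g : \bar R -> R.

Let psiD (f g : \bar R -> R) : continuous f -> continuous g ->
  psi (f \+ g) = psi f + psi g.
Proof.
move=> cf cg; rewrite -[psi f]mul1r -psiZD//; congr psi.
by apply/funext => u /=; rewrite mul1r.
Qed.

Let psi0 : psi (fun=> 0) = 0.
Proof.
have c0 : continuous ((fun=> 0) : \bar R -> R) by exact: cst_continuous.
have := psiD c0 c0; rewrite (_ : _ \+ _ = fun=> 0); first by lra.
by apply/funext => u /=; rewrite addr0.
Qed.

Let below (f : \bar R -> R) :=
  [set psi g | g in [set g : \bar R -> R | continuous g /\ forall u, 0 <= g u <= f u]].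

(** The Riesz decomposition: this and its difference with [psi] are additive and
    nonnegative on nonnegative functions. *)
Definition positive_part (f : \bar R -> R) : R := sup (below f).

Let has_sup_below f : continuous f -> (forall u, 0 <= f u) -> has_sup (below f).
Proof.
move=> cf f0; split.
  exists (psi (fun=> 0)), (fun=> 0) => //; split; first exact: cst_continuous.
  by move=> u; rewrite lexx f0.
have [M [_ Mb]] := ereal_continuous_bounded cf.
have fM u : `|f u| <= M + 1 by apply: Mb => //; rewrite ltrDl.
exists (C * (M + 1)) => _ [g [cg gf] <-].
apply: le_trans (ler_norm _) (psi_bound cg _) => u.
have /andP[g0 gu] := gf u.
by rewrite ger0_norm// (le_trans gu)// (le_trans (ler_norm _)).
Qed.

Let le_positive_part f g : continuous f -> (forall u, 0 <= f u) -> continuous g ->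
  (forall u, 0 <= g u <= f u) -> psi g <= positive_part f.
Proof.
move=> cf f0 cg gf; apply: ub_le_sup; last by exists g.
by have [] := has_sup_below cf f0.
Qed.

Let positive_part_le f x : continuous f -> (forall u, 0 <= f u) ->
  (forall g, continuous g -> (forall u, 0 <= g u <= f u) -> psi g <= x) ->
  positive_part f <= x.
Proof.
move=> cf f0 H; apply: ge_sup; first by have [] := has_sup_below cf f0.
by move=> _ [g [cg gf] <-]; exact: H.
Qed.

Let positive_part_ge0 f : continuous f -> (forall u, 0 <= f u) -> 0 <= positive_part f.
Proof.
move=> cf f0; rewrite -psi0; apply: le_positive_part => //.
  exact: cst_continuous.
by move=> u; rewrite lexx f0.
Qed.

(* A [g] below [f1 + f2] splits as [min g f1], below [f1], plus a rest below
   [f2]. *)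
Let positive_partD (f1 f2 : \bar R -> R) : continuous f1 -> continuous f2 ->
  (forall u, 0 <= f1 u) -> (forall u, 0 <= f2 u) ->
  positive_part (f1 \+ f2) = positive_part f1 + positive_part f2.
Proof.
move=> c1 c2 f10 f20.
have c12 : continuous (f1 \+ f2) by move=> u; apply: cvgD; [exact: c1|exact: c2].
have f120 u : 0 <= (f1 \+ f2) u by rewrite addr_ge0.
apply/eqP; rewrite eq_le; apply/andP; split.
  apply: positive_part_le => // g cg gf.
  pose g1 := g \min f1.
  have cg1 : continuous g1 by move=> u; apply: continuous_min; [exact: cg|exact: c1].
  have cg2 : continuous (g \- g1) by move=> u; apply: cvgB; [exact: cg|exact: cg1].
  have -> : g = g1 \+ (g \- g1) by apply/funext => u /=; rewrite subrKC.
  rewrite psiD// lerD//.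
    apply: le_positive_part => // u; rewrite /g1/= ge_min lexx orbT andbT le_min f10.
    by have /andP[-> _] := gf u.
  apply: le_positive_part => // u; have /andP[g0 gu] := gf u.
  rewrite /g1/= subr_ge0 ge_min lexx/=.
  move: gu => /=; case: (leP (g u) (f1 u)) => h; first by rewrite subrr f20.
  by rewrite lerBlDl.
rewrite -lerBrDr; apply: positive_part_le => // g1 cg1 g1f.
rewrite lerBrDr addrC -lerBrDr; apply: positive_part_le => // g2 cg2 g2f.
rewrite lerBrDr addrC -psiD//; apply: le_positive_part => //.
  by move=> u; apply: cvgD; [exact: cg1|exact: cg2].
move=> u /=; have /andP[? ?] := g1f u; have /andP[? ?] := g2f u.
by rewrite addr_ge0// lerD.
Qed.

(** The measures produced for the two parts of [psi] give a functional that agrees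
    with [psi] on ramps and constants; both being bounded for the supremum norm,
    they agree on the uniform limits of these, that is, on all continuous
    functions. *)
Theorem bounded_functional_integral :
  exists (nu : {charge set R -> \bar R}) (a b : R), forall f : \bar R -> R,
    continuous f ->
    psi f = charge_integral nu (f \o EFin) + a * f -oo%E + b * f +oo%E.
Proof.
have [mup [ap [bp [p1 pramp]]]] :=
  positive_functional_ramp positive_partD positive_part_ge0.
pose negative_part f := positive_part f - psi f.
have negative_partD f g : continuous f -> continuous g ->
    (forall u, 0 <= f u) -> (forall u, 0 <= g u) ->
    negative_part (f \+ g) = negative_part f + negative_part g.
  by move=> cf cg f0 g0; rewrite /negative_part positive_partD// psiD//; lra.
have negative_part_ge0 f : continuous f -> (forall u, 0 <= f u) -> 0 <= negative_part f.
  move=> cf f0; rewrite subr_ge0; apply: le_positive_part => // u.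
  by rewrite f0 lexx.
have [mun [an [bn [n1 nramp]]]] :=
  positive_functional_ramp negative_partD negative_part_ge0.
pose I f := extended_integral mup ap bp f - extended_integral mun an bn f.
pose K := C + ((fine (mup setT) + `|ap| + `|bp|) +
               (fine (mun setT) + `|an| + `|bn|)).
have IZD c f g : continuous f -> continuous g ->
    I (fun u => c * f u + g u) = c * I f + I g.
  by move=> cf cg; rewrite /I !extended_integralZD//; lra.
have I1 : I (fun=> 1) = psi (fun=> 1).
  rewrite /I /extended_integral !mulr1 -p1 -n1 /negative_part; lra.
have Iramp s t : s < t -> I (ramp s t) = psi (ramp s t).
  move=> st; have := pramp _ _ st; have := nramp _ _ st.
  by rewrite /negative_part /I /extended_integral /ramp; lra.
have psiE f : continuous f -> psi f = I f.
  move=> cf; pose V g := continuous g /\ psi g = I g.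
  have c1 : continuous ((fun=> 1) : \bar R -> R) by exact: cst_continuous.
  have V_cst a : V (fun=> a).
    split; first exact: cst_continuous.
    have -> : (fun=> a) = (fun u : \bar R => (a - 1) * 1 + 1).
      by apply/funext => u; rewrite mulr1 subrK.
    by rewrite psiZD// IZD// I1.
  have V_step g a s t : s < t -> V g -> V (fun u => g u + a * (1 - ramp s t u)).
    move=> st [cg Eg]; have cr := ramp_continuous st.
    have cag : continuous (fun u => a * 1 + g u).
      by move=> u; apply: cvgD; [exact: cvg_cst|exact: cg].
    have -> : (fun u => g u + a * (1 - ramp s t u)) =
        (fun u => - a * ramp s t u + (a * 1 + g u)) by apply/funext => u; lra.
    split; last by rewrite psiZD// psiZD// IZD// IZD// I1 Iramp// Eg.
    move=> u; apply: cvgD; last exact: cag.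
    by apply: cvgMr; exact: cr.
  apply/eqP; rewrite -subr_eq0 -normr_le0; apply/ler_addgt0Pr => e e0.
  pose d := e / (`|K| + 1).
  have d0 : 0 < d by rewrite divr_gt0// ltr_wpDl.
  have [g [cg Eg] gf] := ramp_approximation V_cst V_step cf d0.
  have cfg : continuous (fun u => -1 * g u + f u).
    by move=> u; apply: cvgD; [apply: cvgMr; exact: cg|exact: cf].
  have fgd u : `|-1 * g u + f u| <= d by rewrite mulN1r addrC.
  have -> : psi f - I f =
      psi (fun u => -1 * g u + f u) - I (fun u => -1 * g u + f u).
    by rewrite psiZD// IZD// Eg; lra.
  rewrite add0r; apply: le_trans (ler_normB _ _) _.
  apply: (@le_trans _ _ (K * d)).
    rewrite /K mulrDl lerD//; first exact: psi_bound.
    rewrite mulrDl; apply: le_trans (ler_normB _ _) _.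
    by rewrite lerD//; exact: extended_integral_bound.
  rewrite /d mulrCA ger_pMr// ler_pdivrMr ?ltr_wpDl// mul1r.
  by rewrite (le_trans (ler_norm K))// lerDl.
exists (cadd (charge_of_finite_measure mup)
  (cscale (-1) (charge_of_finite_measure mun))).
exists (ap - an), (bp - bn) => f cf; rewrite psiE//.
have mf : measurable_fun setT (f \o EFin).
  exact: measurableT_comp (ereal_continuous_measurable cf) (@measurable_EFin R).
have bf : [bounded (f \o EFin) r | r in setT].
  have [M [Mr Mb]] := ereal_continuous_bounded cf.
  by exists M; split=> // N MN r _; exact: (Mb N MN r%:E).
rewrite charge_integral_cadd// charge_integral_cscale// !charge_integral_measure//.
by rewrite /I /extended_integral/=; lra.
Qed.

End bounded_functional.

(** * Vector-valued functions *)

Section coordinates.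
Variables (R : realType) (n : nat).
Implicit Types (f g : \bar R -> R) (i j : 'I_n).

(** The [i]-th coordinate embedding, defined for every [f] thanks to the default
    value [0], so that no proof of continuity has to be carried along. *)
Definition coord_clim i f : clim R n :=
  insubd (0 : clim R n) (fun r : R => f r%:E *: delta_mx i 0 : 'cV[R]_n).

Let cvg_coord i f (F : set_system R) (l : R) : Filter F ->
  f r%:E @[r --> F] --> l ->
  (f r%:E *: delta_mx i 0 : 'cV[R]_n) @[r --> F] --> (l *: delta_mx i 0 : 'cV[R]_n).
Proof. by move=> FF fl; apply: cvgZr_tmp. Qed.

Let continuous_y f : continuous f -> f r%:E @[r --> +oo] --> f +oo%E.
Proof.
move=> cf A Af; have := cf _ A Af.
by move=> /(nbhs_ereal_pinfty (fun u => A (f u)))[].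
Qed.

Let continuous_Ny f : continuous f -> f r%:E @[r --> -oo] --> f -oo%E.
Proof.
move=> cf A Af; have := cf _ A Af.
by move=> /(nbhs_ereal_ninfty (fun u => A (f u)))[].
Qed.

Lemma coord_climE i f (r : R) : continuous f ->
  coord_clim i f r = f r%:E *: delta_mx i 0.
Proof.
move=> cf; rewrite /coord_clim -[LHS]/(val (insubd _ _) r) insubdK//.
apply/asboolP; split.
- move=> s; apply: cvg_coord => A Af; exact: (cf s%:E A Af).
- apply/cvg_ex; exists (f -oo%E *: delta_mx i 0).
  exact: cvg_coord (continuous_Ny cf).
- apply/cvg_ex; exists (f +oo%E *: delta_mx i 0).
  exact: cvg_coord (continuous_y cf).
Qed.

Lemma clim_ext_coord_clim i f u : continuous f ->
  clim_ext (coord_clim i f) u = f u *: delta_mx i 0.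
Proof.
move=> cf; case: u => [r||] /=; first exact: coord_climE.
- under eq_fun do rewrite coord_climE//.
  by apply: cvg_lim; [exact: norm_hausdorff|exact: cvg_coord (continuous_y cf)].
- under eq_fun do rewrite coord_climE//.
  by apply: cvg_lim; [exact: norm_hausdorff|exact: cvg_coord (continuous_Ny cf)].
Qed.

Lemma coord_climZD i (c : R) f g : continuous f -> continuous g ->
  coord_clim i (fun u => c * f u + g u) = c *: coord_clim i f + coord_clim i g.
Proof.
move=> cf cg; apply/val_inj/funext => r /=.
have cfg : continuous (fun u => c * f u + g u).
  by move=> u; apply: cvgD; [apply: cvgMr; exact: cf|exact: cg].
transitivity ((c * f r%:E + g r%:E) *: delta_mx i 0 : 'cV[R]_n).
  exact: coord_climE cfg.
transitivity (c *: coord_clim i f r + coord_clim i g r); last by [].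
rewrite scalerDl -scalerA; congr (_ + _); last exact/esym/(coord_climE i r cg).
by congr (_ *: _); exact/esym/(coord_climE i r cf).
Qed.

Lemma clim_sum_coord (x : clim R n) :
  x = \sum_i coord_clim i (fun u => clim_ext x u i 0).
Proof.
have valE (s : seq 'I_n) (y : 'I_n -> clim R n) r :
    (\sum_(i <- s) y i) r = \sum_(i <- s) y i r :> 'cV[R]_n.
  by elim/big_ind2 : _ => // y1 z1 y2 z2 <- <-.
apply/val_inj/funext => r.
transitivity (\sum_i coord_clim i (fun u => clim_ext x u i 0) r); last exact/esym/valE.
rewrite [LHS]matrix_sum_delta exchange_big big_ord1.
apply: eq_bigr => i _; rewrite coord_climE//; exact: clim_ext_continuous.
Qed.

Lemma coord_clim_norm i f (M : R) : continuous f -> (forall u, `|f u| <= M) ->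
  `|coord_clim i f| <= `|delta_mx i 0 : 'cV[R]_n| * M.
Proof.
move=> cf fM; apply: supnorm_le => r.
by rewrite coord_climE// normrZ mulrC ler_wpM2l.
Qed.

Lemma vector_charge_integral_coord (mu : 'I_n -> {charge set (\bar R) -> \bar R}) i f :
  continuous f ->
  vector_charge_integral mu (clim_ext (coord_clim i f)) = charge_integral (mu i) f.
Proof.
move=> cf; rewrite /vector_charge_integral (bigD1 i)//= big1 ?addr0.
  congr charge_integral; apply/funext => u.
  by rewrite clim_ext_coord_clim// !mxE !eqxx mulr1.
move=> j ji; rewrite (_ : (fun _ => _) = fun=> 0).
  by rewrite /charge_integral !Rintegral_cst// !mul0r subrr.
by apply/funext => u; rewrite clim_ext_coord_clim// !mxE (negbTE ji) mulr0.
Qed.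

End coordinates.

Section functional.
Variables (R : realType) (n : nat) (phi : {linear clim R n -> R^o}).

Lemma represents_exists : continuous phi ->
  exists (mu : 'I_n -> {charge set R -> \bar R}) (a1 a2 : 'cV[R]_n),
    represents phi mu a1 a2.
Proof.
move=> cphi; have /linear_boundedP/pinfty_ex_gt0[C C0 phiC] :
    bounded_near phi (nbhs (0 : clim R n)).
  exact: continuous_linear_bounded (cphi 0).
have H i : exists nu_ab : {charge set R -> \bar R} * R * R,
    forall f : \bar R -> R, continuous f ->
    phi (coord_clim i f) = charge_integral nu_ab.1.1 (f \o EFin)
      + nu_ab.1.2 * f -oo%E + nu_ab.2 * f +oo%E.
  have [||nu [a [b H]]] := @bounded_functional_integral R
      (fun f => phi (coord_clim i f)) (C * `|delta_mx i 0 : 'cV[R]_n|).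
  - by move=> c f g cf cg; rewrite coord_climZD// linearP.
  - move=> f M cf fM; apply: le_trans (phiC _) _.
    by rewrite -mulrA (ler_wpM2l (ltW C0))//; exact: coord_clim_norm.
  - by exists (nu, a, b).
have {H}[nu H] := choice H.
exists (fun i => (nu i).1.1), (\col_i (nu i).1.2), (\col_i (nu i).2); split.
  by move=> i; exact: every_charge_regular.
move=> x; rewrite {1}(clim_sum_coord x) raddf_sum.
rewrite /vector_charge_integral !mxE -!big_split/=; apply: eq_bigr => i _.
by rewrite H ?mxE//; exact: clim_ext_continuous.
Qed.

Lemma erepresents_unique (mu mu' : 'I_n -> {charge set (\bar R) -> \bar R}) :
  erepresents phi mu -> erepresents phi mu' ->
  forall i A, measurable A -> mu' i A = mu i A.
Proof.
move=> [_ phiE] [_ phiE'] i; apply: charge_unique_continuous => f cf.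
by rewrite -!vector_charge_integral_coord// -phiE -phiE'.
Qed.

End functional.

(* Charges are functions on all subsets, so uniqueness of a measure means
   agreement on all measurable sets. *)
Theorem lemma4p4 (R : realType) (n : nat) (n_gt0 : (0 < n)%N)
    (phi : {linear clim R n -> R^o}) (phi_cont : continuous phi) :
  [/\ exists (mu : 'I_n -> {charge set R -> \bar R}) (a1 a2 : 'cV[R]_n),
        represents phi mu a1 a2 /\
        forall (mu' : 'I_n -> {charge set R -> \bar R}) (a1' a2' : 'cV[R]_n),
          represents phi mu' a1' a2' ->
          [/\ forall (i : 'I_n) (A : set R), measurable A -> mu' i A = mu i A,
              a1' = a1 & a2' = a2],
      exists mut : 'I_n -> {charge set (\bar R) -> \bar R},
        erepresents phi mut /\
        forall mut' : 'I_n -> {charge set (\bar R) -> \bar R},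
          erepresents phi mut' ->
          forall (i : 'I_n) (A : set (\bar R)), measurable A ->
            mut' i A = mut i A &
      forall (mu : 'I_n -> {charge set R -> \bar R}) (a1 a2 : 'cV[R]_n),
        represents phi mu a1 a2 <->
        erepresents phi (fun i => echarge_of (mu i) (a1 i 0) (a2 i 0))].
Proof.
have [mu [a1 [a2 rep]]] := represents_exists phi_cont.
have erep := (represents_echarge_of phi mu a1 a2).1 rep.
split; last exact: represents_echarge_of.
(* [echarge_of nu a b] determines [a], [b] and [nu]: they are its values at the
   two infinities and on the Borel sets of finite points. *)
- exists mu, a1, a2; split => // mu' a1' a2' rep'.
  have E := erepresents_unique erep ((represents_echarge_of phi mu' a1' a2').1 rep').
  have atNy (nu : {charge set R -> \bar R}) a b :
      echarge_of nu a b [set -oo%E] = a%:E.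
    rewrite echarge_ofE (_ : EFin @^-1` _ = set0); last by apply/seteqP; split.
    by rewrite charge0 !diracE in_set1 eqxx in_set1/= mule1 mule0 adde0 add0e.
  have aty (nu : {charge set R -> \bar R}) a b :
      echarge_of nu a b [set +oo%E] = b%:E.
    rewrite echarge_ofE (_ : EFin @^-1` _ = set0); last by apply/seteqP; split.
    by rewrite charge0 !diracE in_set1 in_set1 eqxx/= mule1 mule0 !add0e.
  have atR (nu : {charge set R -> \bar R}) a b (A : set R) :
      echarge_of nu a b (EFin @` A) = nu A.
    rewrite echarge_ofE (_ : EFin @^-1` _ = A); last first.
      by apply/seteqP; split=> [r [s As [<-]]//|r Ar]; exists r.
    by rewrite !diracE !memNset ?mule0 ?adde0//; move=> [].
  split.
  + move=> i A mA; rewrite -(atR _ (a1' i 0) (a2' i 0)) E ?atR//.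
    by exists A => //; exists set0; [constructor|rewrite setU0].
  + apply/colP => i; apply: EFin_inj.
    by rewrite -(atNy (mu' i) _ (a2' i 0)) E ?atNy//; exact: emeasurable_set1.
  + apply/colP => i; apply: EFin_inj.
    by rewrite -(aty (mu' i) (a1' i 0)) E ?aty//; exact: emeasurable_set1.
- exists (fun i => echarge_of (mu i) (a1 i 0) (a2 i 0)); split => // mut'.
  exact: erepresents_unique.
Qed.
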